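(* Let $\Gamma$ be a finite simple graph. Then one can assign to each non-regular point $\xi\in\partial_R\widetilde{S}_\Gamma$ a unique standard subcomplex $Y\subseteq\widetilde{S}_\Gamma$ such that for every combinatorial geodesic ray $r$ representing $\xi$, the subset $Y$ is the smallest standard subcomplex of $\widetilde{S}_\Gamma$ that contains a subray of $r$. This assignment is measurable and $G_\Gamma$-equivariant, and $Y$ is contained in a standard subcomplex of $\widetilde{S}_\Gamma$ which splits non-trivially as a product (that is, a standard subcomplex whose type $\Lambda\subseteq\Gamma$ decomposes as a join of two nonempty subgraphs).
   Context: Right-angled Artin groups and Salvetti complexes. For a finite simple graph $\Gamma$ with vertex set $V\Gamma$, $G_\Gamma=\langle V\Gamma\mid [v,w]=1$ whenever $v,w$ are adjacent$\rangle$. The Salvetti complex $S_\Gamma$ is the cube complex obtained from a bouquet of circles labeled by $V\Gamma$ by gluing one $k$-torus (a $k$-cube with opposite faces identified) for each complete subgraph on $k\ge 2$ vertices; $\pi_1(S_\Gamma)=G_\Gamma$, and its universal cover $\widetilde{S}_\Gamma$ is a $\mathrm{CAT}(0)$ cube complex on which $G_\Gamma$ acts. For a full subgraph $\Lambda\subseteq\Gamma$, $S_\Lambda$ is a subcomplex of $S_\Gamma$; a standard subcomplex of $\widetilde{S}_\Gamma$ of type $\Lambda$ is a connected component of the preimage of $S_\Lambda$ under the covering map $\widetilde{S}_\Gamma\to S_\Gamma$. Roller boundary. Let $X$ be a $\mathrm{CAT}(0)$ cube complex, and let $\mathfrak{H}$ be its set of halfspaces (components of complements of hyperplanes); $\partial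 h$ denotes the boundary hyperplane of $h\in\mathfrak{H}$. The vertex set $V(X)$ embeds in $\{0,1\}^{\mathfrak{H}}$ (product topology), by sending $v$ to the map taking $h$ to $1$ if and only if $v\in h$. The Roller boundary $\partial_R X$ is the complement of $V(X)$ in the closure of its image, and is equipped with its Borel $\sigma$-algebra. For $\xi\in\partial_RX$, $U_\xi\subseteq\mathfrak{H}$ is the set of halfspaces sent to $1$ by $\xi$. A combinatorial geodesic ray is a geodesic ray in the $1$-skeleton $X^{(1)}$ with its path metric; a ray $r$ represents the point $\xi\in\partial_RX$ such that $U_\xi$ is the set of halfspaces that contain a subray of $r$. Regular points. Two hyperplanes are strongly separated if no hyperplane intersects both of them. A point $\xi\in\partial_R X$ is regular if for any two halfspaces $h_1,h_2\in U_\xi$ there exists a halfspace $k\in U_\xi$ with $k\subseteq h_1\cap h_2$ such that for every $i\in\{1,2\}$ the hyperplanes $\partial k$ and $\partial h_i$ are strongly separated; otherwise it is non-regular. Measurability of the assignment is with respect to the Borel $\sigma$-algebra on the set of non-regular points and the discrete $\sigma$-algebra on the countable set of standard subcomplexes. *)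

(* Defs.v *)
From HB Require Import structures.
From Stdlib Require Import Relation_Operators.
From mathcomp Require Import all_boot generic_quotient.
From mathcomp Require Import all_classical topology measure.

Set Implicit Arguments.
Unset Strict Implicit.
Unset Printing Implicit Defensive.

Local Open Scope quotient_scope.
Local Open Scope classical_set_scope.

(** * Groups given by a presentation

    The letter [(x, true)] stands for [x] and [(x, false)] for [x^-1]. *)

Section Presentation.
Variables (X : choiceType) (relator : set (seq (X * bool))).

Definition winv (w : seq (X * bool)) := rev [seq (a.1, ~~ a.2) | a <- w].

Variant trivial_word : set (seq (X * bool)) :=
  | TrivialCancel x b : trivial_word [:: (x, b); (x, ~~ b)]
  | TrivialRelator r : relator r -> trivial_word r.

Variant word_step : seq (X * bool) -> seq (X * bool) -> Prop :=
  WordStep s r t : trivial_word r -> word_step (s ++ r ++ t) (s ++ t).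

Definition word_eq := clos_refl_sym_trans _ word_step.
Definition word_eqb : rel (seq (X * bool)) := fun w1 w2 => `[< word_eq w1 w2 >].

Lemma word_eqb_refl : reflexive word_eqb.
Proof. by move=> w; apply/asboolP; apply: rst_refl. Qed.

Lemma word_eqb_sym : symmetric word_eqb.
Proof.
by move=> w1 w2; apply/asboolP/asboolP => ?; apply: rst_sym.
Qed.

Lemma word_eqb_trans : transitive word_eqb.
Proof.
move=> w2 w1 w3 /asboolP h1 /asboolP h2; apply/asboolP.
exact: rst_trans h1 h2.
Qed.

Canonical word_equiv := EquivRel word_eqb word_eqb_refl word_eqb_sym word_eqb_trans.

Definition presented : Type := {eq_quot word_equiv}.
HB.instance Definition _ := Choice.on presented.
HB.instance Definition _ := EqQuotient.on presented.

Lemma presentedP (w1 w2 : seq (X * bool)) :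
  \pi_presented w1 = \pi_presented w2 <-> word_eq w1 w2.
Proof.
by split=> [/eqmodP/asboolP|h] //; apply/eqmodP/asboolP.
Qed.

Lemma word_eq_cat a1 a2 b1 b2 :
  word_eq a1 a2 -> word_eq b1 b2 -> word_eq (a1 ++ b1) (a2 ++ b2).
Proof.
move=> ha hb; apply: (@rst_trans _ _ _ (a2 ++ b1)).
  elim: ha => {a1 a2} [_ _ [s r t tr]|x|x y _ |x y z _ h1 _ h2].
  - by apply: rst_step; rewrite -!catA; constructor.
  - exact: rst_refl.
  - exact: rst_sym.
  - exact: rst_trans h1 h2.
elim: hb => {b1 b2} [_ _ [s r t tr]|x|x y _ |x y z _ h1 _ h2].
- by apply: rst_step; rewrite !(catA a2); constructor.
- exact: rst_refl.
- exact: rst_sym.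
- exact: rst_trans h1 h2.
Qed.

Lemma winvK : involutive winv.
Proof.
move=> w; rewrite /winv map_rev revK -map_comp -[RHS]map_id.
by apply: eq_map => -[x b] /=; rewrite negbK.
Qed.

Lemma winv_cons a w : winv (a :: w) = winv w ++ [:: (a.1, ~~ a.2)].
Proof. by rewrite /winv /= rev_cons cats1. Qed.

Lemma word_eq_mulV w : word_eq (w ++ winv w) [::].
Proof.
elim: w => [|[x b] w IHw]; first exact: rst_refl.
rewrite winv_cons -cat1s -catA (catA w).
apply: (@rst_trans _ _ _ ([:: (x, b)] ++ [::] ++ [:: (x, ~~ b)])).
  apply: word_eq_cat; first exact: rst_refl.
  by apply: word_eq_cat => //; exact: rst_refl.
apply: rst_step; exact: (@WordStep [::] [:: (x, b); (x, ~~ b)] [::]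
  (TrivialCancel x b)).
Qed.

Lemma word_eq_Vmul w : word_eq (winv w ++ w) [::].
Proof. by rewrite -{2}(winvK w); apply: word_eq_mulV. Qed.

Lemma word_eq_inv w1 w2 : word_eq w1 w2 -> word_eq (winv w1) (winv w2).
Proof.
have refl w : word_eq w w by exact: rst_refl.
move=> h; apply: (@rst_trans _ _ _ (winv w1 ++ w2 ++ winv w2)).
  apply: rst_sym; have := word_eq_cat (refl (winv w1)) (word_eq_mulV w2).
  by rewrite cats0.
rewrite catA; apply: (@word_eq_cat _ [::]) => //.
apply: rst_trans (word_eq_Vmul w1).
by apply: word_eq_cat => //; exact: rst_sym.
Qed.

Definition pres_one : presented := \pi_presented [::].
Definition pres_mul (g h : presented) : presented := \pi_presented (repr g ++ repr h).
Definition pres_inv (g : presented) : presented := \pi_presented (winv (repr g)).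

Lemma repr_pi w : word_eq (repr (\pi_presented w)) w.
Proof. by apply/presentedP; rewrite reprK. Qed.

Lemma pres_mul_pi w1 w2 : pres_mul (\pi_presented w1) (\pi_presented w2) = \pi_presented (w1 ++ w2).
Proof. by apply/presentedP; apply: word_eq_cat; apply: repr_pi. Qed.

Lemma pres_inv_pi w : pres_inv (\pi_presented w) = \pi_presented (winv w).
Proof. by apply/presentedP; apply: word_eq_inv; apply: repr_pi. Qed.

Lemma pres_mulA : associative pres_mul.
Proof.
move=> g h k; rewrite -(reprK g) -(reprK h) -(reprK k).
move: (repr g) (repr h) (repr k) => a b c.
by rewrite (pres_mul_pi b c) (pres_mul_pi a b) (pres_mul_pi a) (pres_mul_pi _ c) catA.
Qed.

Lemma pres_mul1g : left_id pres_one pres_mul.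
Proof. by move=> g; rewrite -(reprK g) [LHS]pres_mul_pi. Qed.

Lemma pres_mulg1 : right_id pres_one pres_mul.
Proof. by move=> g; rewrite -(reprK g) [LHS]pres_mul_pi cats0. Qed.

Lemma pres_mulVg : left_inverse pres_one pres_inv pres_mul.
Proof.
move=> g; rewrite -(reprK g) pres_inv_pi [LHS]pres_mul_pi.
by apply/presentedP; apply: word_eq_Vmul.
Qed.

Lemma pres_mulgV : right_inverse pres_one pres_inv pres_mul.
Proof.
move=> g; rewrite -(reprK g) pres_inv_pi [LHS]pres_mul_pi.
by apply/presentedP; apply: word_eq_mulV.
Qed.

HB.instance Definition _ :=
  isGroup.Build presented pres_mulA pres_mul1g pres_mulg1 pres_mulVg pres_mulgV.

Definition pres_gen (x : X) : presented := \pi_presented [:: (x, true)].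

End Presentation.

(** * Cube complexes

    Cubes are attached combinatorially: [face c i b] is the codimension-one
    face of [c] on which the [i]-th coordinate is [0] ([b = false]) or [1]
    ([b = true]); it is only meaningful for [i < cube_dim c].  The second axiom is
    the usual cubical identity. *)

Record cube_complex := CubeComplex {
  cell : Type;
  cube_dim : cell -> nat;
  face : cell -> nat -> bool -> cell;
  dim_face : forall c i b, (i < cube_dim c)%N -> cube_dim (face c i b) = (cube_dim c).-1;
  face_face : forall c i j b b', (i < j < cube_dim c)%N ->
    face (face c j b') i b = face (face c i b) j.-1 b'
}.

Section CubeComplex.
Variable X : cube_complex.
Implicit Types (c e : cell X) (u v : cell X) (H K L A Z : set (cell X)).

Definition facet c c' : Prop :=
  exists i b, (i < cube_dim c')%N /\ c = face c' i b.

Definition is_face := clos_refl_trans (cell X) facet.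

Definition component_in Z c : set (cell X) :=
  [set d | clos_refl_sym_trans (cell X)
             (fun a b => [/\ Z a, Z b & facet a b]) c d].

Definition is_component Z Y : Prop := exists2 c, Z c & Y = component_in Z c.

Definition joins e u v : Prop :=
  cube_dim e = 1 /\ exists b, u = face e 0 b /\ v = face e 0 (~~ b).

Fixpoint walk (n : nat) u v : Prop :=
  if n is n'.+1 then exists2 w, exists e, joins e u w & walk n' w v
  else u = v.

(* [n] is the distance from [u] to [v] in the 1-skeleton. *)
Definition dist_is u v (n : nat) : Prop :=
  walk n u v /\ forall k, walk k u v -> (n <= k)%N.

Definition geodesic_ray (r : nat -> cell X) : Prop :=
  (forall n, cube_dim (r n) = 0) /\
  (forall m n, (m <= n)%N -> dist_is (r m) (r n) (n - m)).

Definition contains_subray (r : nat -> cell X) Y : Prop :=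
  exists N, forall n, (N <= n)%N -> exists2 e, joins e (r n) (r n.+1) & Y e.

(** A hyperplane is encoded by the set of edges dual to it, i.e. by a class of
    the equivalence relation generated by being opposite in a square. *)
Definition opposite e e' : Prop :=
  exists s i, [/\ cube_dim s = 2, (i < 2)%N, e = face s i false & e' = face s i true].

Definition is_hyperplane H : Prop :=
  exists2 e, cube_dim e = 1 & H = [set e' | clos_refl_sym_trans _ opposite e e'].

(* Two hyperplanes intersect iff they have midcubes in a common cube; in
   particular a hyperplane intersects itself. *)
Definition intersects H K : Prop :=
  exists c e e', [/\ is_face e c, is_face e' c, H e & K e'].

Definition strongly_separated H K : Prop :=
  ~ exists L, [/\ is_hyperplane L, intersects L H & intersects L K].

(* The vertices of the component of [u] in the complement of [H]. *)
Definition side H u : set (cell X) :=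
  [set v | clos_refl_sym_trans (cell X)
             (fun a b => exists2 e, joins e a b & ~ H e) u v].

(** A halfspace is encoded by its set of vertices, together with the
    hyperplane it is a component of the complement of; in a CAT(0) cube
    complex the latter is determined by the former. *)
Record halfspace := Halfspace {
  bdry : set (cell X);
  hset :> set (cell X);
  bdry_hyperplane : is_hyperplane bdry;
  hset_side : exists2 u, cube_dim u = 0 & hset = side bdry u
}.

(** [{0,1}^halfspaces] with the product topology *)
Definition orientation : Type := {ptws halfspace -> bool}.
HB.instance Definition _ := Topological.on orientation.
Implicit Types xi : orientation.

Definition vertex_orientation v : orientation := fun h => `[< hset h v >].

Definition roller_boundary : set orientation :=
  let V := [set vertex_orientation v | v in [set v | cube_dim v = 0]] in
  closure V `\` V.

Definition represents (r : nat -> cell X) xi : Prop :=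
  forall h, xi h <-> exists N, forall n, (N <= n)%N -> hset h (r n).

Definition regular_point xi : Prop :=
  forall h1 h2, xi h1 -> xi h2 -> exists k,
    [/\ xi k, hset k `<=` hset h1 `&` hset h2,
        strongly_separated (bdry k) (bdry h1)
      & strongly_separated (bdry k) (bdry h2)].

Definition nonregular : set orientation :=
  [set xi | roller_boundary xi /\ ~ regular_point xi].

(** The action on orientations of an automorphism given by its action on
    cells: the halfspaces of the image are the images of the halfspaces. *)
Definition push (f : cell X -> cell X) xi : orientation :=
  fun h => `[< exists2 k, xi k & hset h = f @` hset k >].

(** The Borel sigma-algebra of a subspace [D], as a family of subsets of [D] *)
Definition borel_on (D : set orientation) : set (set orientation) :=
  <<s D, [set D `&` U | U in [set U | open U]] >>.

End CubeComplex.

(** * Right-angled Artin groups and Salvetti complexes *)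

Record sgraph := SGraph {
  vertex :> finType;
  adj : rel vertex;
  adj_sym : symmetric adj;
  adj_irr : irreflexive adj
}.

Section Salvetti.
Local Open Scope group_scope.
Variable G : sgraph.
Implicit Types (x y : G) (L : {set G}).

Definition commutators : set (seq (G * bool)) :=
  [set w | exists2 p : G * G, adj p.1 p.2 &
     w = [:: (p.1, true); (p.2, true); (p.1, false); (p.2, false)]].

Definition raag : groupType := presented commutators.
Definition rgen x : raag := pres_gen commutators x.

Lemma rgenC x y : adj x y -> rgen x * rgen y = rgen y * rgen x.
Proof.
move=> xy; suff h : rgen x * rgen y * ((rgen x)^-1 * (rgen y)^-1) = 1.
  by apply: (mulIg ((rgen y * rgen x)^-1)); rewrite mulgV invgM.
have e z : (rgen z)^-1 = \pi_(presented commutators) [:: (z, false)].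
  exact: pres_inv_pi.
rewrite !e /rgen /pres_gen; set a := \pi_(_) _; set b := \pi_(_) _.
have mul_pi w1 w2 : \pi_(presented commutators) w1 * \pi_(presented commutators) w2
    = \pi_(presented commutators) (w1 ++ w2) by exact: pres_mul_pi.
rewrite /a /b (mul_pi [:: (x, true)]) (mul_pi [:: (x, false)]).
rewrite (mul_pi [:: (x, true); (y, true)]).
apply/presentedP; apply: rst_step.
apply: (@WordStep _ _ [::] [:: (x, true); (y, true); (x, false); (y, false)] [::]).
by apply: TrivialRelator; exists (x, y).
Qed.

Definition is_clique L := [forall x in L, forall y in L, (x != y) ==> adj x y].
Definition clique := {L : {set G} | is_clique L}.

Lemma is_clique_del L x : is_clique L -> is_clique (L :\ x).
Proof.
move=> /'forall_implyP cl; apply/'forall_implyP => y /setD1P[_ yL].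
apply/'forall_implyP => z /setD1P[_ zL].
by move/'forall_implyP: (cl y yL); apply.
Qed.

Definition clique_del (c : clique) x : clique :=
  exist is_clique (sval c :\ x) (is_clique_del x (svalP c)).

(** The torus of a clique [c] is the cube whose coordinates are the elements
    of [c], in the order of [enum]; opposite faces are identified with the
    torus of the smaller clique. *)
Definition salvetti_face (c : clique) (i : nat) (_ : bool) : clique :=
  if onth (enum (sval c)) i is Some x then clique_del c x else c.

Lemma clique_enum (c : clique) i : (i < #|sval c|)%N ->
  exists2 x, x \in sval c & onth (enum (sval c)) i = Some x.
Proof.
rewrite cardE -onthTE; case E: onth => [x|] // _; exists x => //.
by rewrite -mem_enum; apply/onthP; exists i.
Qed.

Lemma onth_enum_del (L : {set G}) x i k : onth (enum L) k = Some x ->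
  onth (enum (L :\ x)) i = onth (enum L) (if (i < k)%N then i else i.+1).
Proof.
move=> Lk.
have kL : (k < size (enum L))%N by rewrite -onthTE Lk.
have -> : enum (L :\ x) = take k (enum L) ++ drop k.+1 (enum L).
  have ik : index x (enum L) = k.
    apply: (@onth_inj _ (enum L)); rewrite ?enum_uniq //.
      by rewrite gtn_min kL.
    have xL : x \in enum L by apply/onthP; exists k.
    by rewrite Lk onthE (nth_map x) ?index_mem // nth_index.
  rewrite -ik -remE rem_filter ?enum_uniq // /enum_mem -filter_predI.
  by apply: eq_filter => y; rewrite /= !inE.
rewrite onth_cat size_take kL; case: ifP => ik.
  by rewrite onthE map_take nth_take // -onthE.
rewrite onthE map_drop nth_drop -onthE; congr onth.
by rewrite addSn subnKC // leqNgt ik.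
Qed.

Lemma clique_del_swap (c : clique) x y :
  clique_del (clique_del c x) y = clique_del (clique_del c y) x.
Proof. by apply: val_inj; apply/setP => z; rewrite !inE andbCA. Qed.

Fact salvetti_dim_face (c : clique) i b : (i < #|sval c|)%N ->
  #|sval (salvetti_face c i b)| = #|sval c|.-1.
Proof.
case/clique_enum => x xc; rewrite /salvetti_face => ->.
by rewrite /= [in RHS](cardsD1 x) xc.
Qed.

Fact salvetti_face_face (c : clique) i j b b' : (i < j < #|sval c|)%N ->
  salvetti_face (salvetti_face c j b') i b =
  salvetti_face (salvetti_face c i b) j.-1 b'.
Proof.
case/andP => ij jc; have ic := ltn_trans ij jc.
have [x xc xi] := clique_enum ic; have [y yc yj] := clique_enum jc.
rewrite /salvetti_face xi yj /= (onth_enum_del _ yj) (onth_enum_del _ xi).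
case: j ij yj {jc} => // j; rewrite ltnS => ij yj /=.
have ji : (j < i)%N = false by rewrite ltnNge ij.
by rewrite ij ji xi yj clique_del_swap.
Qed.

Definition salvetti : cube_complex :=
  CubeComplex salvetti_dim_face salvetti_face_face.

Definition salvetti_sub L : set (cell salvetti) :=
  [set c : clique | sval c \subset L].

(** The universal cover of the Salvetti complex.  Edge paths from the only
    vertex of [salvetti] are words in the generators and their inverses, and
    their homotopy classes are the elements of [raag]; hence the vertices of
    the cover are these elements, and [(g, c)] is the lift of the cube [c] with
    initial corner [g]. *)
Definition cover_face (a : raag * clique) (i : nat) (b : bool) : raag * clique :=
  if onth (enum (sval a.2)) i is Some x
  then (if b then a.1 * rgen x else a.1, clique_del a.2 x) else a.

Fact cover_dim_face (a : raag * clique) i b : (i < #|sval a.2|)%N ->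
  #|sval (cover_face a i b).2| = #|sval a.2|.-1.
Proof.
move=> ia; rewrite -(salvetti_dim_face b ia) /cover_face /salvetti_face.
by case: onth.
Qed.

Fact cover_face_face (a : raag * clique) i j b b' : (i < j < #|sval a.2|)%N ->
  cover_face (cover_face a j b') i b = cover_face (cover_face a i b) j.-1 b'.
Proof.
case: a => g c /= /andP[ij jc]; have ic := ltn_trans ij jc.
have [x xc xi] := clique_enum ic; have [y yc yj] := clique_enum jc.
have xy : adj x y.
  have /'forall_implyP/(_ x xc)/'forall_implyP/(_ y yc)/implyP := svalP c.
  apply; apply/eqP => exy; rewrite exy -yj in xi.
  have eij : i = j.
    apply: (onth_inj (enum (sval c))) xi; first exact: enum_uniq.
    by rewrite -cardE; apply: leq_ltn_trans (geq_minr _ _) ic.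
  by rewrite eij ltnn in ij.
rewrite /cover_face /= xi yj /= (onth_enum_del _ yj) (onth_enum_del _ xi).
case: j ij yj {jc} => // j; rewrite ltnS => ij yj /=.
have ji : (j < i)%N = false by rewrite ltnNge ij.
rewrite ij ji xi yj clique_del_swap.
by case: b; case: b' => //=; rewrite -!mulgA (rgenC xy).
Qed.

Definition salvetti_cover : cube_complex := CubeComplex cover_dim_face cover_face_face.

Definition covering_map (a : cell salvetti_cover) : cell salvetti := a.2.

Lemma covering_map_face (a : cell salvetti_cover) i b :
  covering_map (face a i b) = face (covering_map a) i b.
Proof. by case: a => g c; rewrite /= /cover_face /salvetti_face /=; case: onth. Qed.

Definition translate (g : raag) (a : cell salvetti_cover) : cell salvetti_cover := (g * a.1, a.2).

Lemma translate_face g (a : cell salvetti_cover) i b :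
  translate g (face a i b) = face (translate g a) i b.
Proof.
rewrite /translate /= /cover_face /=; case: onth => // x.
by case: b; rewrite //= mulgA.
Qed.

Definition standard_of_type L (Y : set (cell salvetti_cover)) : Prop :=
  is_component (covering_map @^-1` salvetti_sub L) Y.

Definition standard (Y : set (cell salvetti_cover)) : Prop :=
  exists L, standard_of_type L Y.

Definition smallest_standard (r : nat -> cell salvetti_cover) (Y : set (cell salvetti_cover)) :=
  [/\ standard Y, contains_subray r Y
    & forall Z, standard Z -> contains_subray r Z -> Y `<=` Z].

Definition carrier (xi : orientation salvetti_cover) (Y : set (cell salvetti_cover)) : Prop :=
  standard Y /\
  forall r, geodesic_ray r -> represents r xi -> smallest_standard r Y.

Definition is_join L : Prop :=
  exists A B : {set G}, [/\ A != finset.set0, B != finset.set0, A :&: B = finset.set0,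
    L = A :|: B & {in A & B, forall x y, adj x y}].

End Salvetti.

(* Main.v *)
(** A hyperplane is the class of an edge [(k, {x})], i.e. the edges [(k l, {x})]
    with [l] in the subgroup generated by the link of [x].  The parity of the
    number of its edges on a path does not change under cancellation or
    commutation of letters, so it separates the cover into two sides; geodesics
    cross it at most once, and disjoint hyperplanes bound nested halfspaces.

    Let [r] be a geodesic ray representing [xi] (one is built greedily) and [L] the
    set of labels it crosses infinitely often.  The standard subcomplex of type [L]
    containing the end of [r] does not depend on [r]: among the pairs [(M, g)] such
    that no hyperplane with label outside [M] separates [g] from [xi], it is the
    one with smallest [M].  This description is visibly equivariant, and Borel
    since it involves countably many closed conditions.

    If [L] is neither a join nor contained in the link of a vertex, then, the
    complement graph of [L] being connected, past any hyperplane [H] separating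
    from [xi] the ray crosses chains of nested hyperplanes carrying all labels of
    [L].  A hyperplane meeting [H] and a late one would cross the whole chain, so
    its label would be adjacent to all of [L]: hence [xi] is regular. *)

Require Import Defs.
From Stdlib Require Import Relation_Operators.
From mathcomp Require Import all_boot generic_quotient.
From mathcomp Require Import all_classical topology measure.

Set Implicit Arguments.
Unset Strict Implicit.
Unset Printing Implicit Defensive.

Local Open Scope quotient_scope.
Local Open Scope classical_set_scope.

(** * Words and walls *)

Section Walls.
Local Open Scope group_scope.
Variable G : sgraph.
Implicit Types (x y z : G) (a b : G * bool) (u v w : seq (G * bool)).
Implicit Types (g h k p q : raag G).

Definition ev w : raag G := \pi_(presented (@commutators G)) w.

Lemma ev_cat u v : ev (u ++ v) = ev u * ev v.
Proof. exact/esym/pres_mul_pi. Qed.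

Lemma ev_nil : ev [::] = 1.
Proof. by []. Qed.

Lemma ev_winv w : ev (winv w) = (ev w)^-1.
Proof. exact/esym/pres_inv_pi. Qed.

Lemma evP u v : ev u = ev v <-> word_eq (@commutators G) u v.
Proof. exact: presentedP. Qed.

Definition word_of g : seq (G * bool) := repr (g : presented (@commutators G)).

Lemma word_ofK g : ev (word_of g) = g.
Proof. exact: reprK. Qed.

Definition letter a : raag G := ev [:: a].

Lemma ev_cons a w : ev (a :: w) = letter a * ev w.
Proof. by rewrite -cat1s ev_cat. Qed.

Lemma ev_rcons a w : ev (rcons w a) = ev w * letter a.
Proof. by rewrite -cats1 ev_cat. Qed.

Lemma letterV a : letter (a.1, ~~ a.2) = (letter a)^-1.
Proof. by rewrite /letter -ev_winv. Qed.

Lemma letter_rgen x : letter (x, true) = rgen x.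
Proof. by []. Qed.

Lemma letterC a b : adj a.1 b.1 -> letter a * letter b = letter b * letter a.
Proof.
have lE c : letter c = if c.2 then rgen c.1 else (rgen c.1)^-1.
  case: c => x [] //=; exact: (letterV (x, true)).
move=> ab; have c : commute (rgen a.1) (rgen b.1) by apply: rgenC.
have cV := commuteV c; have Vc := esym (commuteV (esym c)).
rewrite !lE; case: a.2; case: b.2; [exact: c|exact: cV|exact: Vc|].
exact: (commuteV Vc).
Qed.

Lemma ev_letterC a w : all (fun b => adj a.1 b.1) w -> letter a * ev w = ev w * letter a.
Proof.
elim: w => [|b w IH] /=; first by rewrite mulg1 mul1g.
by case/andP=> ab aw; rewrite ev_cons mulgA (letterC ab) -!mulgA IH.
Qed.

(* A wall [(k, x)] stands for the hyperplane dual to the edge [(k, {x})]. *)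
Definition wall : Type := (raag G * G)%type.
Implicit Types H K : wall.

Definition in_link x g : Prop := exists2 w, all (fun b => adj x b.1) w & g = ev w.

(* The edge traversed from [g] by the letter [a] is [(edge_base g a, {a.1})]. *)
Definition edge_base g a : raag G := if a.2 then g else g * letter a.

Definition crosses H g a : bool :=
  (a.1 == H.2) && `[< in_link H.2 (H.1^-1 * edge_base g a) >].

Fixpoint ncross H g w : nat :=
  if w is a :: w' then (crosses H g a + ncross H (g * letter a) w')%N else 0.

(** The word chosen by [word_of] is immaterial: by [odd_ncross] every word for [H.1^-1 * g] gives
    the same parity. *)
Definition pside H g : bool := odd (ncross H H.1 (word_of (H.1^-1 * g))).

Lemma in_link1 x : in_link x 1.
Proof. by exists [::]. Qed.

Lemma in_linkM x g h : in_link x g -> in_link x h -> in_link x (g * h).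
Proof.
move=> [u hu ->] [v hv ->]; exists (u ++ v); last by rewrite ev_cat.
by rewrite all_cat hu.
Qed.

Lemma in_linkV x g : in_link x g -> in_link x g^-1.
Proof.
move=> [u hu ->]; exists (winv u); last by rewrite ev_winv.
by rewrite all_rev all_map; apply: sub_all hu => -[].
Qed.

Lemma in_link_letter x a : adj x a.1 -> in_link x (letter a).
Proof. by move=> xa; exists [:: a]; rewrite //= xa. Qed.

Lemma in_linkMr x g h : in_link x h -> in_link x (g * h) <-> in_link x g.
Proof.
move=> hh; split=> [hg|hg]; last exact: in_linkM.
by rewrite -(mulgK h g); apply: in_linkM => //; apply: in_linkV.
Qed.

Lemma in_linkC a g : in_link a.1 g -> letter a * g = g * letter a.
Proof. by move=> [w hw ->]; apply: ev_letterC. Qed.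

Lemma ncross_cat H g u v :
  ncross H g (u ++ v) = (ncross H g u + ncross H (g * ev u) v)%N.
Proof.
elim: u g => [|a u IH] g /=; first by rewrite ev_nil mulg1.
by rewrite IH ev_cons mulgA addnA.
Qed.

Lemma edge_baseV g a : edge_base (g * letter a) (a.1, ~~ a.2) = edge_base g a.
Proof. by rewrite /edge_base letterV mulgK; case: a => x []. Qed.

Lemma edge_baseM h g a : edge_base (h * g) a = h * edge_base g a.
Proof. by rewrite /edge_base; case: a.2; rewrite ?mulgA. Qed.

Lemma crossesV H g a : crosses H (g * letter a) (a.1, ~~ a.2) = crosses H g a.
Proof. by rewrite /crosses edge_baseV. Qed.

Lemma crossesM h H g a : crosses (h * H.1, H.2) (h * g) a = crosses H g a.
Proof. by rewrite /crosses edge_baseM /= invgM -mulgA mulKg. Qed.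

(** The two edges are opposite in a square, so their bases differ by a letter of the link of
    [a.1]. *)
Lemma crosses_square H g a b : adj a.1 b.1 -> crosses H (g * letter b) a = crosses H g a.
Proof.
move=> ab; rewrite /crosses; case: eqP => //= xa; congr asbool; apply/propext.
have -> : edge_base (g * letter b) a = edge_base g a * letter b.
  by rewrite /edge_base; case: a.2; rewrite // -!mulgA (letterC ab).
by rewrite mulgA; apply: in_linkMr; apply: in_link_letter; rewrite -xa.
Qed.

(** A cancelling pair traverses one edge twice; a commutator runs around a square and meets each of
    its two hyperplanes in a pair of opposite edges. *)
Lemma ncross_trivial H g w : trivial_word (@commutators G) w -> ~~ odd (ncross H g w).
Proof.
case=> [x b|r [[x y] /= xy ->]].
  by rewrite /= (crossesV H g (x, b)) addn0 addnn odd_double.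
have yx : adj y x by rewrite adj_sym.
rewrite /= addn0.
rewrite (crosses_square H g (a := (y, true)) (b := (x, true))) //=.
have -> : crosses H (g * letter (x, true) * letter (y, true)) (x, false) =
          crosses H (g * letter (y, true)) (x, true).
  by rewrite -mulgA (@letterC (x, true) (y, true)) // mulgA; apply: (crossesV H _ (x, true)).
rewrite (crosses_square H g (a := (x, true)) (b := (y, true))) //=.
have -> : crosses H (g * letter (x, true) * letter (y, true) * letter (x, false)) (y, false) =
          crosses H g (y, true).
  rewrite -(mulgA g) (@letterC (x, true) (y, true)) // mulgA.
  by rewrite (letterV (x, true)) mulgK; apply: (crossesV H _ (y, true)).
by rewrite !oddD; case: crosses; case: crosses.
Qed.

Lemma odd_ncross H g u v : ev u = ev v -> odd (ncross H g u) = odd (ncross H g v).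
Proof.
move/evP; elim=> {u v} [_ _ [s r t tr]|//|u v _ -> //|u v w _ -> _ -> //].
rewrite !ncross_cat !oddD (negbTE (ncross_trivial _ _ tr)) addFb.
suff -> : ev r = 1 by rewrite mulg1.
rewrite -ev_nil; apply/evP; apply: rst_step.
by rewrite -[r]cats0; apply: (@WordStep _ _ [::] r [::]).
Qed.

Lemma pside_ev H g w : pside H (g * ev w) = pside H g (+) odd (ncross H g w).
Proof.
rewrite /pside.
rewrite (@odd_ncross _ _ _ (word_of (H.1^-1 * g) ++ w)).
  by rewrite ncross_cat oddD word_ofK mulVKg.
by rewrite ev_cat !word_ofK mulgA.
Qed.

Lemma pside_letter H g a : pside H (g * letter a) = pside H g (+) crosses H g a.
Proof. by rewrite pside_ev /= addn0; case: crosses. Qed.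

Lemma pside_base H : pside H H.1 = false.
Proof.
rewrite /pside mulVg (@odd_ncross _ _ _ [::]) //.
by rewrite word_ofK.
Qed.

Definition wall_at g a : wall := (edge_base g a, a.1).

Lemma crosses_at g a : crosses (wall_at g a) g a.
Proof. by rewrite /crosses eqxx mulVg /=; apply/asboolP/in_link1. Qed.

Lemma crosses_label H g a : crosses H g a -> a.1 = H.2.
Proof. by case/andP=> /eqP. Qed.

Lemma ncross_label H g w : (forall b, b \in w -> b.1 != H.2) -> ncross H g w = 0.
Proof.
elim: w g => [//|b w IH] g hw /=.
rewrite IH => [|c cw]; last by apply: hw; rewrite inE cw orbT.
by rewrite /crosses (negbTE (hw b _)) // mem_head.
Qed.

(** A path inside the link of [K.2] has no letter labelled [H.2], since the labels are not adjacent;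
    it cannot cross [H]. *)
Lemma pside_link H K g : ~~ adj K.2 H.2 -> in_link K.2 (K.1^-1 * g) ->
  pside H g = pside H K.1.
Proof.
move=> nadj [w hw e]; rewrite -(mulVKg K.1 g) e pside_ev ncross_label ?addbF //.
by move=> b /(allP hw); apply: contraTneq => ->.
Qed.

Lemma pside_eq H K :
  K.2 = H.2 -> in_link H.2 (H.1^-1 * K.1) -> pside K =1 pside H.
Proof.
case: H K => h x [k y] /= -> hk.
have ec g a : crosses (k, x) g a = crosses (h, x) g a.
  rewrite /crosses /=; congr (_ && _); congr asbool; apply/propext.
  have -> : h^-1 * edge_base g a = (h^-1 * k) * (k^-1 * edge_base g a).
    by rewrite -!mulgA mulVKg.
  split=> [|hc]; first exact: in_linkM.
  by rewrite -(mulKg (h^-1 * k) (k^-1 * _)); apply: in_linkM => //; apply: in_linkV.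
move=> g; have en p w : ncross (k, x) p w = ncross (h, x) p w.
  by elim: w p => [|a w IH] p //=; rewrite ec IH.
have := @pside_link (h, x) (h, x) k.
rewrite /= adj_irr => /(_ isT hk) ekh.
rewrite -(mulVKg k g) -(word_ofK (k^-1 * g)) !pside_ev en.
by rewrite (pside_base (k, x)) ekh (pside_base (h, x)).
Qed.

Lemma crosses_wall H g a : crosses H g a -> pside (wall_at g a) =1 pside H.
Proof. by case/andP=> /eqP xa /asboolP hl; apply: (@pside_eq H (wall_at g a)). Qed.

(** Equality of hyperplanes for different representatives [(k, x)]. Sides are compared without
    exchange because [pside] is false at the initial end of every dual edge. *)
Definition same_wall H K : Prop := pside H =1 pside K.

Lemma crossesE H g a : crosses H g a = (pside H g != pside H (g * letter a)).
Proof. by rewrite pside_letter; case: pside; case: crosses. Qed.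

Lemma same_crosses H K g a : same_wall H K -> crosses H g a = crosses K g a.
Proof. by move=> e; rewrite !crossesE !e. Qed.

Lemma crosses_same H K g a : crosses H g a -> crosses K g a -> same_wall H K.
Proof. by move=> hH hK p; rewrite -(crosses_wall hH) (crosses_wall hK). Qed.

Lemma pside_top H : pside H (H.1 * letter (H.2, true)) = true.
Proof.
rewrite pside_letter pside_base /=.
have := crosses_at H.1 (H.2, true).
by rewrite /wall_at /edge_base /=; case: H.
Qed.

Lemma pside_mul h H g : pside (h * H.1, H.2) (h * g) = pside H g.
Proof.
rewrite /pside /= invgM -mulgA mulKg; move: (word_of _) => w.
have : forall p, ncross (h * H.1, H.2) (h * p) w = ncross H p w.
  by elim: w => [//|a w IH] p /=; rewrite crossesM -mulgA IH.
by move=> ->.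
Qed.

End Walls.

(** * Halfspaces and geodesic words *)

Section Convexity.
Local Open Scope group_scope.
Variable G : sgraph.
Implicit Types (x y z : G) (a b : G * bool) (u v w : seq (G * bool)).
Implicit Types (g h k p q : raag G) (H K : wall G).

Definition joined H : raag G -> raag G -> Prop :=
  clos_refl_sym_trans _ (fun p q => exists2 a, q = p * letter a & ~~ crosses H p a).

Lemma joined_ev H g w : ncross H g w = 0 -> joined H g (g * ev w).
Proof.
elim: w g => [|a w IH] g /=; first by rewrite ev_nil mulg1; move=> _; apply: rst_refl.
move/eqP; rewrite addn_eq0 eqb0 => /andP[ca /eqP cw].
rewrite ev_cons mulgA; apply: rst_trans (IH _ cw).
by apply: rst_step; exists a.
Qed.

Lemma joined_link H g h : in_link H.2 h -> joined H g (g * h).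
Proof.
move=> [w hw ->]; apply: joined_ev; apply: ncross_label => b /(allP hw).
by apply: contraTneq => ->; rewrite adj_irr.
Qed.

Lemma crosses_end H g a : crosses H g a ->
  exists2 h, in_link H.2 h & g = (if a.2 then H.1 else H.1 * letter (H.2, true)) * h.
Proof.
case: a => x [] /andP[/= /eqP -> /asboolP]; rewrite /edge_base /= => hl.
  by exists (H.1^-1 * g) => //; rewrite mulVKg.
exists (H.1^-1 * (g * letter (H.2, false))) => //.
have e : letter (H.2, false) = (letter (H.2, true))^-1 by rewrite -letterV.
by rewrite -mulgA in_linkC //= mulgA mulVKg e mulgVK.
Qed.

(** At most two components: a path that crosses [H] lands at an end of a dual edge, and from there
    one slides along [H], by link letters, to an end of the base edge. *)
Lemma joined_base H g : joined H g H.1 \/ joined H g (H.1 * letter (H.2, true)).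
Proof.
suff base w : joined H H.1 (H.1 * ev w) \/ joined H (H.1 * letter (H.2, true)) (H.1 * ev w).
  have := base (word_of (H.1^-1 * g)); rewrite word_ofK mulVKg.
  by case=> h; [left|right]; apply: rst_sym.
elim/last_ind: w => [|w a IH]; first by rewrite ev_nil mulg1; left; apply: rst_refl.
rewrite ev_rcons mulgA; set p := H.1 * ev w in IH *.
case ca: (crosses H p a); last first.
  have pa : joined H p (p * letter a) by apply: rst_step; exists a; rewrite ?ca.
  by case: IH => h; [left|right]; apply: rst_trans h pa.
have : crosses H (p * letter a) (a.1, ~~ a.2) by rewrite crossesV.
case/crosses_end=> h hl ->; case: (~~ a.2); [left|right]; exact: joined_link.
Qed.

(** The complement of a hyperplane has exactly two components, told apart by the crossing parity. *)
Lemma joinedP H g h : joined H g h <-> pside H g = pside H h.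
Proof.
have jE p q : joined H p q -> pside H p = pside H q.
  elim=> {p q} [p q [a ->]|//|p q _ -> //|p q r _ -> _ -> //].
  by rewrite pside_letter => /negbTE ->; rewrite addbF.
split; first exact: jE.
move=> e; case: (joined_base H g) => jg; case: (joined_base H h) => jh.
- by apply: rst_trans jg _; apply: rst_sym.
- by move: (jE _ _ jg) (jE _ _ jh); rewrite -e => ->; rewrite pside_base pside_top.
- by move: (jE _ _ jg) (jE _ _ jh); rewrite -e => ->; rewrite pside_base pside_top.
- by apply: rst_trans jg _; apply: rst_sym.
Qed.

Lemma crosses_side H g a : crosses H g a -> pside H g = ~~ a.2.
Proof.
have lk K k : in_link K.2 (K.1^-1 * k) -> pside K k = false.
  by move=> hk; rewrite -(pside_base K); apply: pside_link; rewrite ?adj_irr.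
case: a => x [] c; case/andP: (c) => /= _ /asboolP; rewrite /edge_base /= => /lk //.
by rewrite pside_letter c; case: pside.
Qed.

Lemma crosses_same_side H K g a p b :
  ~~ adj K.2 H.2 -> ~ same_wall K H -> crosses K g a -> crosses K p b ->
  pside H g = pside H p.
Proof.
move=> nadj ns.
suff base q c : crosses K q c -> pside H q = pside H K.1 by move=> /base -> /base ->.
move=> cK; have ncH : ~~ crosses H q c by apply/negP => cH; apply: ns; apply: crosses_same cK cH.
case/andP: cK => _ /asboolP /(pside_link nadj); rewrite /edge_base.
by case: c.2; rewrite // pside_letter (negbTE ncH) addbF.
Qed.

(** A path from [g] to [h] avoiding [H] stays on the side of [H] where, by [crosses_same_side], no
    edge is dual to [K]. *)
Lemma far_side_const H K p a g h :
  ~~ adj K.2 H.2 -> ~ same_wall K H -> crosses K p a ->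
  pside H g != pside H p -> pside H g = pside H h -> pside K g = pside K h.
Proof.
move=> nadj ns cK hg /joinedP gh.
have hh : pside H h != pside H p by move/joinedP: gh => <-.
elim: gh hg hh => {g h} [q r [c -> ncH]|//|q r _ IH hq hr|q r s qr IH1 _ IH2 hq hs].
- rewrite [pside K (_ * _)]pside_letter => hq _.
  case cK': (crosses K q c); last by rewrite addbF.
  by rewrite (crosses_same_side nadj ns cK' cK) eqxx in hq.
- by rewrite IH.
- have hr : pside H r != pside H p by move/joinedP: qr => <-.
  by rewrite IH1 // IH2.
Qed.

(* Along a path from [g] to [p] that crosses [H] and then continues through [K],
   the halfspace of [K] ahead lies inside that of [H]. *)
Lemma nested H K g p a q :
  ~~ adj K.2 H.2 -> ~ same_wall K H -> crosses K p a ->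
  pside H g != pside H p -> pside K g = pside K p -> pside K q != pside K p ->
  pside H q = pside H p.
Proof.
move=> nadj ns cK hu ku kq; case: (eqVneq (pside H q) (pside H p)) => // hq.
have e : pside H q = pside H g by move: hu hq; do 3!case: pside.
by rewrite (far_side_const nadj ns cK hq e) ku eqxx in kq.
Qed.

Lemma ncross_split H g w : (0 < ncross H g w)%N ->
  exists u b v, [/\ w = u ++ b :: v, ncross H g u = 0 & crosses H (g * ev u) b].
Proof.
elim: w g => [//|a w IH] g /=; case ca: (crosses H g a) => /=.
  by exists [::], a, w; rewrite ev_nil mulg1.
case/IH=> u [b [v [-> nu cb]]]; exists (a :: u), b, v.
by rewrite /= ca nu ev_cons mulgA.
Qed.

(** Two successive crossings of [H] go in opposite directions along edges whose bases differ by a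
    link element. This element commutes with the letter, so both letters can be deleted without
    changing the product. *)
Lemma ncross_shorten H g w : (1 < ncross H g w)%N ->
  exists2 w', ev w' = ev w & (size w' < size w)%N.
Proof.
elim: w g => [//|a w IH] g /=; case ca: (crosses H g a) => /=; last first.
  by case/IH=> w' e s; exists (a :: w'); rewrite ?ev_cons ?e.
rewrite ltnS => /ncross_split[u [b [v [-> nu cb]]]].
exists (u ++ v); last by rewrite /= !size_cat /= addnS ltnS leqnSn.
have bE : b = (a.1, ~~ a.2).
  rewrite [LHS]surjective_pairing (crosses_label cb) -(crosses_label ca); congr (_, _).
  have := crosses_side cb; rewrite pside_ev nu addbF pside_letter ca (crosses_side ca).
  by case: a.2; case: b.2.
have hl : in_link H.2 ((edge_base g a)^-1 * edge_base (g * letter a * ev u) b).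
  case/andP: ca => _ /asboolP l1; case/andP: cb => _ /asboolP l2.
  have -> : (edge_base g a)^-1 * edge_base (g * letter a * ev u) b =
    (H.1^-1 * edge_base g a)^-1 * (H.1^-1 * edge_base (g * letter a * ev u) b).
    by rewrite invgM invgK -!mulgA mulVKg.
  by apply: in_linkM => //; apply: in_linkV.
suff e : letter a * ev u * letter b = ev u.
  by rewrite ev_cons !ev_cat ev_cons !mulgA e.
have lb : letter b = (letter a)^-1 by rewrite bE letterV.
rewrite -(crosses_label ca) in hl; rewrite lb.
have := in_linkC hl; have b2 : b.2 = ~~ a.2 by rewrite bE.
rewrite /edge_base b2 lb; case: a.2 => /=.
  by rewrite -!mulgA !mulKg mulVg mulg1 => /mulgI.
by rewrite mulKg => ->; rewrite mulgK.
Qed.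

(** * Shortest words and standard cosets *)

Definition reduced w : Prop := forall w', ev w' = ev w -> (size w <= size w')%N.

Lemma ncross_reduced H g w : reduced w ->
  ncross H g w = (pside H g != pside H (g * ev w)).
Proof.
move=> rw; have : (ncross H g w <= 1)%N.
  rewrite leqNgt; apply/negP => /ncross_shorten[w' /rw]; rewrite leqNgt.
  by move=> /negP.
rewrite pside_ev; case: ncross => [|[|//]] _ /=; by case: pside.
Qed.

Lemma reduced_ex g : exists2 w, ev w = g & reduced w.
Proof.
have ex : exists n, `[< exists2 w, ev w = g & size w = n >].
  by exists (size (word_of g)); apply/asboolP; exists (word_of g); rewrite ?word_ofK.
case: (ex_minnP ex) => n /asboolP[w e <-] min; exists w => // w' e'.
by apply: min; apply/asboolP; exists w'; rewrite ?e'.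
Qed.

Definition agree_off (L : {set G}) g h : Prop :=
  forall H, H.2 \notin L -> pside H g = pside H h.

(** A shortest word from [g] to [h] crosses only walls separating them, so its letters lie in [L].
    Thus [agree_off L] is the relation of lying in the same coset of the subgroup generated by
    [L]. *)
Lemma agree_offP (L : {set G}) g h :
  agree_off L g h <-> exists2 w, all (fun a => a.1 \in L) w & h = g * ev w.
Proof.
split=> [gh|[w wL ->] H HL]; last first.
  rewrite pside_ev ncross_label ?addbF // => b /(allP wL).
  by apply: contraTneq => ->.
have [w e rw] := reduced_ex (g^-1 * h); exists w; last by rewrite e mulVKg.
apply/allP => b /splitPr w_uv; case: w_uv e rw => u v e rw.
apply: contraT => bL; have := ncross_reduced (wall_at (g * ev u) b) g rw.
rewrite e mulVKg gh // eqxx ncross_cat /= crosses_at => /eqP.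
by rewrite addn_eq0 => /andP[].
Qed.

Definition shortest_across H g w : Prop :=
  pside H (g * ev w) != pside H g /\
  forall w', pside H (g * ev w') != pside H g -> (size w <= size w')%N.

Lemma shortest_ex H g h : pside H h != pside H g -> exists w, shortest_across H g w.
Proof.
move=> hg.
have ex : exists n, `[< exists2 w, pside H (g * ev w) != pside H g & size w = n >].
  exists (size (word_of (g^-1 * h))); apply/asboolP.
  by exists (word_of (g^-1 * h)); rewrite ?word_ofK ?mulVKg.
case: (ex_minnP ex) => n /asboolP[w e <-] min; exists w; split=> // w' e'.
by apply: min; apply/asboolP; exists w'.
Qed.

Lemma shortest_reduced H g w : shortest_across H g w -> reduced w.
Proof. by case=> hw min w' e; apply: min; rewrite e. Qed.

(* A letter of a shortest path across [H] cannot commute with all later ones,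
   since it could then be deleted; so each wall met is nested behind a later one,
   and all of them separate [g] from the whole halfspace of [H] across. *)
Lemma shortest_walls H g w K q : shortest_across H g w -> (0 < ncross K g w)%N ->
  pside H q != pside H g -> pside K q != pside K g.
Proof.
elim: w g K => [//|a w IH] g K sw; have rw := shortest_reduced sw; case: sw => hw min /=.
have e1 : g * letter a * ev w = g * ev (a :: w) by rewrite ev_cons mulgA.
case cH: (crosses H g a).
  have w0 : w = [::].
    apply/nilP; rewrite /nilp -leqn0 -ltnS; apply: (min [:: a]).
    by rewrite pside_ev /= cH; case: pside.
  rewrite {}w0 /= addn0; case cK: (crosses K g a) => // _.
  by rewrite !(crosses_same cK cH).
have eH : pside H (g * letter a) = pside H g by rewrite pside_letter cH addbF.
have sw1 : shortest_across H (g * letter a) w.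
  split=> [|w']; first by rewrite e1 eH.
  by rewrite eH -mulgA -ev_cons => /min.
have ncrw K' : (crosses K' g a + ncross K' (g * letter a) w =
    (pside K' g != pside K' (g * ev (a :: w))))%N by exact: (ncross_reduced K' g rw).
have IHw K' : (0 < ncross K' (g * letter a) w)%N -> pside H q != pside H g ->
    pside K' q != pside K' g.
  move=> c hq; have := IH _ _ sw1 c; rewrite eH => /(_ hq).
  rewrite pside_letter; case cK: (crosses K' g a); last by rewrite addbF.
  by have := ncrw K'; rewrite cK; case: ncross c => // n _; case: (_ != _).
case cK: (crosses K g a); last by rewrite add0n; apply: IHw.
move=> _ hq.
(* If the first letter commutes with all later ones, its label is adjacent to [H.2]. Moved to the
   end it does not cross [H], so the word without it is a shorter way across. *)
case: (boolP (all (fun b => adj a.1 b.1) w)) => [aw|].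
  have /ncross_split[u [b [v [wE _ cb]]]] : (0 < ncross H (g * letter a) w)%N.
    have := ncrw H; rewrite cH add0n => ->; by rewrite eq_sym hw.
  have aH : adj a.1 H.2.
    by rewrite -(crosses_label cb); apply: (allP aw); rewrite wE mem_cat mem_head orbT.
  suff /min : pside H (g * ev w) != pside H g by rewrite ltnn.
  have := hw; rewrite ev_cons ev_letterC // mulgA pside_letter /crosses.
  case: (a.1 =P H.2) => [aE|_]; last by rewrite addbF.
  by rewrite aE adj_irr in aH.
move/allPn=> [b bw nab].
have [u [v wE]] : exists u v, w = u ++ b :: v by case/splitPr: bw => u v; exists u, v.
(* Otherwise [K'] is the wall of a later letter whose label is not adjacent to that of the first. By
   induction [q] lies beyond [K'], and the halfspace beyond [K'] is nested in the one beyond [K]. *)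
pose p := g * letter a * ev u; pose K' := wall_at p b.
have cp : crosses K' p b by exact: crosses_at.
have cw : (0 < ncross K' (g * letter a) w)%N by rewrite wE ncross_cat /= cp addnCA.
have nca : crosses K' g a = false.
  by have := ncrw K'; case: (crosses K' g a) => //; case: ncross cw => // n _; case: (_ != _).
have ncu K'' : (ncross K'' (g * letter a) u + crosses K'' p b <=
    ncross K'' (g * letter a) w)%N by rewrite wE ncross_cat /= addnA leq_addr.
have up : pside K' p = pside K' g.
  have := ncrw K'; have := ncu K'; rewrite cp nca add0n addn1 => c1 c2.
  rewrite pside_ev pside_letter nca addbF.
  have : (ncross K' (g * letter a) u < 1)%N by apply: leq_trans c1 _; rewrite c2 leq_b1.
  by case: ncross; rewrite ?addbF.
have ncK : ncross K (g * letter a) w = 0.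
  have := ncrw K; rewrite cK; case: ncross => // n; by case: (_ != _).
have ncKu : ncross K (g * letter a) u = 0 /\ crosses K p b = false.
  have := ncu K; rewrite ncK leqn0 addn_eq0 => /andP[/eqP -> /eqP]; by case: crosses.
have hKp : pside K g != pside K p.
  by rewrite pside_ev ncKu.1 addbF pside_letter cK; case: pside.
have lK' : K'.2 = b.1 by []. 
have ns : ~ same_wall K' K.
  by move=> e; move: ncKu.2; rewrite -(same_crosses _ _ e) cp.
have nadj : ~~ adj K'.2 K.2 by rewrite lK' -(crosses_label cK) adj_sym.
have hK'q : pside K' q != pside K' p by rewrite up; apply: IHw.
by rewrite (nested nadj ns cp hKp (esym up) hK'q) eq_sym.
Qed.

End Convexity.

(** * Rays *)

Section Rays.
Local Open Scope group_scope.
Variable G : sgraph.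
Implicit Types (x y z : G) (b c : G * bool) (u v w : seq (G * bool)).
Implicit Types (i j k m n N M T d : nat) (g h p q : raag G) (H K : wall G) (L : {set G}).
Implicit Types (s : wall G -> bool) (a : nat -> G * bool) (r : nat -> raag G).

(** Any finitely many of the prescribed sides are realised by a vertex; this is the form in which
    membership in the closure of the vertices is used. *)
Definition coherent s : Prop :=
  forall Hs : seq (wall G), exists g, forall H, H \in Hs -> pside H g = s H.

Definition settled s L g : Prop := forall H, H.2 \notin L -> pside H g = s H.

(* [core s L g] says that the coset of [g] by the subgroup generated by [L] is
   the smallest standard coset containing the ends of the rays towards [s]. *)
Definition core s L g : Prop :=
  settled s L g /\ forall L' h, settled s L' h -> L \subset L'.

Definition tends s r : Prop :=
  forall H, exists N, forall n, (N <= n)%N -> pside H (r n) = s H.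

(** [approach_sep] encodes geodesicity: the wall of the [n]-th edge is crossed at that step only,
    towards [s], so [r m] is past it exactly for [m > n]. *)
Record approaches s r a : Prop := Approaches {
  approach_step : forall n, r n.+1 = r n * letter (a n);
  approach_sep : forall m n,
    (pside (wall_at (r n) (a n)) (r m) == s (wall_at (r n) (a n))) = (n < m)%N;
  approach_tends : tends s r
}.

Lemma coherent_same s H K : coherent s -> same_wall H K -> s H = s K.
Proof.
move=> /(_ [:: H; K])[g hg] e.
by rewrite -(hg H) ?mem_head // -(hg K) ?inE ?eqxx ?orbT.
Qed.

Definition seg a m k : seq (G * bool) := mkseq (fun i => a (m + i)%N) k.

Lemma seg_rcons a m k : seg a m k.+1 = rcons (seg a m k) (a (m + k)%N).
Proof. exact: mkseqS. Qed.

Lemma ray_seg r a : (forall n, r n.+1 = r n * letter (a n)) ->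
  forall m k, r (m + k)%N = r m * ev (seg a m k).
Proof.
move=> st m; elim=> [|k IH]; first by rewrite addn0 ev_nil mulg1.
by rewrite addnS st IH seg_rcons ev_rcons mulgA.
Qed.

(** Segments of the ray are reduced, so no wall is crossed twice; the side after the crossing is
    therefore final, and [tends] identifies it with that of [s]. *)
Lemma geodesic_approaches s r a :
  (forall n, r n.+1 = r n * letter (a n)) ->
  (forall m n w, (m <= n)%N -> r n = r m * ev w -> (n - m <= size w)%N) ->
  tends s r -> approaches s r a.
Proof.
move=> st geo td; split=> // m n; set W := wall_at _ _.
have red i k : reduced (seg a i k).
  move=> w e; have := geo i (i + k)%N w (leq_addr _ _).
  by rewrite e -ray_seg // addKn size_mkseq; apply.
have cn : crosses W (r n) (a n) by exact: crosses_at.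
have before i : (i <= n)%N -> pside W (r i) = pside W (r n).
  move=> le; have rn : r n = r i * ev (seg a i (n - i)) by rewrite -ray_seg // subnKC.
  have := ncross_reduced W (r i) (red i (n - i).+1).
  rewrite seg_rcons -cats1 ncross_cat -rn /= subnKC // cn addn0 addn1 => c1.
  suff c0 : ncross W (r i) (seg a i (n - i)) = 0 by rewrite rn pside_ev c0 addbF.
  by apply/eqP; rewrite -leqn0 -ltnS c1 leq_b1.
have after i : (n < i)%N -> pside W (r i) = ~~ pside W (r n).
  move=> lt; have := ncross_reduced W (r n) (red n (i - n)).
  rewrite -(ray_seg st) subnKC ?(ltnW lt) //.
  have -> : (i - n = (i - n).-1.+1)%N by rewrite prednK ?subn_gt0.
  rewrite /seg /mkseq /= addn0 cn.
  by case: (pside W (r n)); case: (pside W (r i)).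
have sW : s W = ~~ pside W (r n).
  have [N hN] := td W; rewrite -(hN (maxn N n.+1)) ?leq_maxl // after //.
  exact: leq_maxr.
case: leqP => [/before|/after] ->; rewrite sW; by case: pside.
Qed.

(** * The walls met by a fixed ray, and its recurrent labels *)

Section Approach.
Variables (s : wall G -> bool) (r : nat -> raag G) (a : nat -> G * bool).
Hypothesis ap : approaches s r a.
Let W n := wall_at (r n) (a n).
Let st := approach_step ap.
Let sep m n : (pside (W n) (r m) == s (W n)) = (n < m)%N := approach_sep ap m n.
Let td := approach_tends ap.

Lemma approach_same H K : same_wall H K -> s H = s K.
Proof.
move=> e; have [N hN] := td H; have [M hM] := td K.
by rewrite -(hN (maxn N M)) ?leq_maxl // e hM ?leq_maxr.
Qed.

Lemma ray_wall_inj i j : same_wall (W i) (W j) -> i = j.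
Proof.
move=> e; have h m : (i < m)%N = (j < m)%N by rewrite -!sep (approach_same e) e.
have := h i.+1; have := h j.+1; rewrite !ltnSn !ltnS => ij ji.
by apply/eqP; rewrite eqn_leq ij -ji.
Qed.

(** Each letter of a word from [g] to [h] crosses at most one wall of the ray, since these walls are
    pairwise distinct. *)
Lemma ray_walls_eventually g h :
  exists N, forall n, (N <= n)%N -> pside (W n) g = pside (W n) h.
Proof.
rewrite -(mulVKg g h) -(word_ofK (g^-1 * h)); move: (word_of (g^-1 * h)) => w.
elim: w g => [|b w IH] g.
  by exists 0 => n _; rewrite ev_nil mulg1.
have [N hN] := IH (g * letter b).
have [M hM] : exists M, forall n, (M <= n)%N -> crosses (W n) g b = false.
  have [[n hn]|no] := pselect (exists n, crosses (W n) g b).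
    exists n.+1 => m lt; apply/negP => hm; move: lt.
    by rewrite (ray_wall_inj (crosses_same hm hn)) ltnn.
  by exists 0 => n _; apply/negP => hn; apply: no; exists n.
exists (maxn N M) => n; rewrite geq_max => /andP[/hN nN /hM nM].
by rewrite ev_cons mulgA -nN pside_letter nM addbF.
Qed.

Lemma ray_crosses_all g h i k w : h = g * ev w -> g = r i -> h = r (i + k)%N ->
  (k <= size w)%N.
Proof.
move=> e gi hk.
(* The bound is proved by induction on [w] for any set of separating indices: the first letter
   crosses at most one of their walls, and the others still separate. *)
suff bound (js : seq nat) : uniq js ->
    (forall j, j \in js -> pside (W j) g != pside (W j) h) -> (size js <= size w)%N.
  rewrite -(size_iota i k); apply: bound; first exact: iota_uniq.
  move=> j; rewrite mem_iota gi hk => /andP[ij jk].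
  have := sep i j; have := sep (i + k) j; rewrite jk ltnNge ij /= => /eqP -> /negbT.
  by [].
move=> uj; rewrite {}e {gi hk}; elim: w g js uj => [|b w IH] g js uj sepj.
  case: js sepj {uj} => // j js /(_ j (mem_head _ _)).
  by rewrite ev_nil mulg1 eqxx.
rewrite -(count_predC (fun j => crosses (W j) g b)) -!size_filter.
have c1 : (size [seq j <- js | crosses (W j) g b] <= 1)%N.
  case E: [seq _ <- _ | _] => [|i1 [|i2 t]] //.
  have m1 : i1 \in [seq j <- js | crosses (W j) g b] by rewrite E mem_head.
  have m2 : i2 \in [seq j <- js | crosses (W j) g b] by rewrite E !inE eqxx orbT.
  move: m1 m2; rewrite !mem_filter => /andP[h1 _] /andP[h2 _].
  have := filter_uniq (fun j => crosses (W j) g b) uj; rewrite E /=.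
  by rewrite (ray_wall_inj (crosses_same h1 h2)) mem_head.
apply: leq_add c1 _; apply: (IH (g * letter b)); first exact: filter_uniq.
move=> j; rewrite mem_filter => /andP[/= ncj jj].
have := sepj j jj; by rewrite ev_cons mulgA pside_letter (negbTE ncj) addbF.
Qed.

Definition recurrent : {set G} :=
  [set x | `[< forall N, exists2 n, (N <= n)%N & (a n).1 = x >]].

Lemma recurrentP x :
  reflect (forall N, exists2 n, (N <= n)%N & (a n).1 = x) (x \in recurrent).
Proof. by rewrite inE; apply: asboolP. Qed.

Lemma uniform_bound (P : G -> nat -> Prop) :
  (forall x, exists N, forall n, (N <= n)%N -> P x n) ->
  exists N, forall x n, (N <= n)%N -> P x n.
Proof.
move=> /choice[f hf]; exists (\max_x f x) => x n hn; apply: hf.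
exact: leq_trans (leq_bigmax x) hn.
Qed.

Lemma eventually_recurrent : exists N, forall n, (N <= n)%N -> (a n).1 \in recurrent.
Proof.
have [N hN] : exists N, forall x n, (N <= n)%N -> (a n).1 = x -> x \in recurrent.
  apply: uniform_bound => x; case: (boolP (x \in recurrent)) => [_|]; first by exists 0.
  rewrite inE => /asboolPn /existsNP[N hN]; exists N => n Nn xn.
  by case: hN; exists n.
by exists N => n /hN; apply.
Qed.

Lemma settled_tail L N : (forall n, (N <= n)%N -> (a n).1 \in L) ->
  forall n, (N <= n)%N -> settled s L (r n).
Proof.
move=> aL n Nn H HL; have [M hM] := td H.
rewrite -(hM (n + M)%N (leq_addl _ _)) (ray_seg st) pside_ev ncross_label ?addbF //.
move=> b /mapP[i _ ->]; apply: contraNneq HL => <-; apply: aL.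
exact: leq_trans (leq_addr _ _).
Qed.

(** A recurrent label outside [L] labels arbitrarily late walls of the ray. Late walls do not
    separate [g] from [r 0], so they separate [g] from [s], although [g] is settled off [L]. *)
Lemma recurrent_min L g : settled s L g -> recurrent \subset L.
Proof.
move=> sL; apply/fintype.subsetP => x /recurrentP rx; apply: contraT => xL.
have [N hN] := ray_walls_eventually g (r 0).
have [n /hN e ax] := rx N.
have WL : (W n).2 \notin L by rewrite /= ax.
by have := sep 0 n; rewrite -e (sL _ WL) eqxx.
Qed.

Lemma core_tail : exists N, forall n, (N <= n)%N ->
  core s recurrent (r n) /\ (a n).1 \in recurrent.
Proof.
have [N hN] := eventually_recurrent; exists N => n Nn; split; last exact: hN.
by split; [apply: settled_tail hN _ Nn|exact: recurrent_min].
Qed.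

(** * Nested halfspaces along the ray *)

Definition ahead n q : Prop := pside (W n) q = s (W n).

Definition deeper n m : Prop := (n < m)%N /\ forall q, ahead m q -> ahead n q.

Lemma deeper_trans n m k : deeper n m -> deeper m k -> deeper n k.
Proof.
by move=> [nm h1] [mk h2]; split=> [|q /h2 /h1 //]; apply: ltn_trans mk.
Qed.

Lemma ray_before m n : (m <= n)%N -> pside (W n) (r m) = ~~ s (W n).
Proof. by move=> mn; have := sep m n; rewrite ltnNge mn; case: pside; case: (s _). Qed.

Lemma ray_after m n : (n < m)%N -> pside (W n) (r m) = s (W n).
Proof. by move=> lt; apply/eqP; rewrite sep. Qed.

Lemma deeper_nonadj n m : (n < m)%N -> ~~ adj (a m).1 (a n).1 -> deeper n m.
Proof.
move=> nm nadj; split=> // q qm; rewrite /ahead -(ray_after nm).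
apply: (nested (K := W m) (g := r n) (a := a m)) => //.
- by move/ray_wall_inj => e; rewrite e ltnn in nm.
- exact: crosses_at.
- by rewrite ray_before // ray_after //; case: (s _).
- by rewrite !ray_before // ltnW.
- by rewrite qm ray_before //; case: (s _).
Qed.

(* The labels eventually deeper than [n] form a set [R] closed under
   non-adjacency, so [recurrent] is the join of [R] and its complement unless
   [R] is everything. *)
Lemma deeper_eventually n : ~ is_join recurrent -> (a n).1 \in recurrent ->
  exists N, forall m, (N <= m)%N -> deeper n m.
Proof.
move=> nj an.
pose R : {set G} := 
  finset (fun z => (z \in recurrent) &&
    `[< exists T, forall m, (T <= m)%N -> (a m).1 = z -> deeper n m >]).
have RP z : z \in R -> exists T, forall m, (T <= m)%N -> (a m).1 = z -> deeper n m.
  by rewrite inE => /andP[_ /asboolP].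
have RE : R = recurrent.
  apply/eqP; rewrite finset.eqEsubset; apply/andP; split.
    by apply/fintype.subsetP => z; rewrite inE => /andP[].
  rewrite -finset.setD_eq0; apply/negPn/negP => ne; apply: nj.
  exists R, (recurrent :\: R); split=> //.
  (* The label of [W n] itself belongs to [R], because no label is adjacent to itself. *)
  - apply/set0Pn; exists (a n).1; rewrite inE an; apply/asboolP; exists n.+1 => m nm e.
    by apply: deeper_nonadj; rewrite // e adj_irr.
  - by apply/setP => z; rewrite finset.in_setI finset.in_setD finset.in_set0; case: (z \in R).
  - apply/setP => z; rewrite finset.in_setU finset.in_setD.
    by case: (boolP (z \in R)) => //=; rewrite inE => /andP[->].
  (* If [z] is in [R] and the recurrent label [z'] is not adjacent to it, every late wall labelled
     [z'] is nested behind a wall labelled [z] that is already deeper than [n]; so [z'] is in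
     [R]. *)
  move=> z z' zR; rewrite !finset.in_setD => /andP[z'R z'r]; apply: contraNT z'R => nadj.
  rewrite inE z'r; apply/asboolP; have [T hT] := RP _ zR.
  have /recurrentP/(_ T)[m0 Tm0 am0] : z \in recurrent by move: zR; rewrite inE => /andP[].
  exists m0.+1 => m m0m am; apply: deeper_trans (hT _ Tm0 am0) _.
  by apply: deeper_nonadj; rewrite // am am0 adj_sym.
have [T hT] : exists T, forall z m, (T <= m)%N -> (a m).1 = z -> z \in recurrent -> deeper n m.
  apply: uniform_bound => z; case: (boolP (z \in recurrent)) => [|_]; last by exists 0.
  by rewrite -RE => /RP[T hT]; exists T => m Tm e _; apply: hT.
have [N hN] := eventually_recurrent.
exists (maxn T N) => m; rewrite geq_max => /andP[Tm Nm].
by apply: hT Tm _ (hN _ Nm).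
Qed.

Lemma enter_halfspace H : exists N, forall n, (N <= n)%N ->
  [/\ pside H (r n) = s H, ~ same_wall (W n) H
    & ~~ adj (a n).1 H.2 -> forall q, ahead n q -> pside H q = s H].
Proof.
(* A vertex [h] behind [H] starts the path required by [nested]: late walls of the ray do not
   separate it from [r 0], so it is behind them too. *)
have [h hh] : exists h, pside H h != s H.
  case: (s H); first by exists H.1; rewrite pside_base.
  by exists (H.1 * letter (H.2, true)); rewrite pside_top.
have [N hN] := td H; have [M hM] := ray_walls_eventually h (r 0).
exists (maxn N M) => n; rewrite geq_max => /andP[Nn Mn].
have ns : ~ same_wall (W n) H.
  move=> e; have := crosses_at (r n) (a n); rewrite (same_crosses _ _ e) crossesE -st.
  by rewrite !hN ?eqxx // ltnW.
split=> //; first exact: hN.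
move=> nadj q qn; rewrite -(hN n) //.
apply: (nested (K := W n) (g := h) (a := a n)) => //.
- exact: crosses_at.
- by rewrite hN.
- by rewrite hM // !ray_before.
- by rewrite qn ray_before //; case: (s _).
Qed.

(* [y] is the label of a wall meeting both [H] (at [g]) and [W m] (at [h]): such a
   wall also crosses walls of every recurrent label nested in between. *)
Lemma separated_eventually H : ~ is_join recurrent ->
  (exists2 x, x \in recurrent & ~~ adj x H.2) ->
  exists N, forall m, (N <= m)%N ->
    (forall q, ahead m q -> pside H q = s H) /\
    forall y g h b c, crosses H g b -> crosses (W m) h c -> in_link y (g^-1 * h) ->
      {in recurrent, forall z, adj y z}.
Proof.
move=> nj [x xr nadj].
have [T0 hT0] := enter_halfspace H.
have /recurrentP/(_ T0)[n Tn an] := xr.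
have [sHn nsn inH] := hT0 n Tn.
have ahH q : ahead n q -> pside H q = s H by apply: inH; rewrite an.
have [T1 hT1] : exists T, forall m, (T <= m)%N -> deeper n m.
  by apply: deeper_eventually; rewrite ?an.
(* For [m] late enough, a wall of every recurrent label lies strictly between [W n] and [W m]. *)
have [T2 hT2] : exists T, forall z m, (T <= m)%N -> z \in recurrent ->
    exists k, [/\ (a k).1 = z, deeper n k & deeper k m].
  apply: uniform_bound => z; case: (boolP (z \in recurrent)) => [zr|_]; last by exists 0.
  have /recurrentP/(_ T1)[k Tk ak] := zr.
  have [T hT] : exists T, forall m, (T <= m)%N -> deeper k m.
    by apply: deeper_eventually; rewrite ?ak.
  by exists T => m /hT km _; exists k; split=> //; apply: hT1.
exists (maxn T1 T2) => m; rewrite geq_max => /andP[/hT1[_ mn] /hT2 mz].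
split=> [q /mn /ahH //|y g h b c cg ch [w wy hE] z /mz[k [ak [nk kn] [km mk]]]].
have nsk : ~ same_wall (W k) H.
  move=> e; have := ray_before (ltnW nk); rewrite e (approach_same e) sHn.
  by case: (s H).
(* If [g] were past [W k], so would be the other end of its edge dual to [H], and both ends would
   lie on the same side of [H]. *)
have gk : ~ ahead k g.
  move=> gk; have gH := ahH _ (kn _ gk).
  case ck: (crosses (W k) g b); first exact: nsk (crosses_same ck cg).
  have : ahead k (g * letter b) by rewrite /ahead pside_letter ck addbF.
  by move/kn/ahH; rewrite pside_letter cg gH; case: (s H).
(* One end of the edge dual to [W m] is past [W m], hence past [W k]; the edge does not cross [W k],
   so both ends are. *)
have hk : ahead k h.
  have [hm|hm] := pselect (ahead m h); first exact: mk.
  have /mk : ahead m (h * letter c).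
    by move: hm; rewrite /ahead pside_letter ch; case: pside; case: (s _).
  rewrite /ahead pside_letter; case ck: (crosses (W k) h c); last by rewrite addbF.
  by have e := ray_wall_inj (crosses_same ck ch); rewrite e ltnn in km.
(* The word from [g] to [h] in the link of [y] has to cross [W k], so it contains a letter labelled
   [z]. *)
apply: contraT => nyz; case: gk; rewrite /ahead -hk -(mulVKg g h) hE pside_ev.
rewrite ncross_label ?addbF // => d /(allP wy); apply: contraTneq => ->.
by rewrite /= ak.
Qed.

End Approach.

(** * Existence of rays *)

Lemma toward_settled s r a m n H : coherent s ->
  (forall n, r n.+1 = r n * letter (a n)) ->
  (forall n, pside (wall_at (r n) (a n)) (r n) != s (wall_at (r n) (a n))) ->
  (m <= n)%N -> pside H (r m) = s H -> pside H (r n) = s H.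
Proof.
move=> coh st tw; elim: n => [|n IH]; first by rewrite leqn0 => /eqP ->.
rewrite leq_eqVlt => /predU1P[->//|mn] /(IH mn) e.
rewrite st pside_letter; case c: (crosses H (r n) (a n)); last by rewrite addbF.
have eW : same_wall (wall_at (r n) (a n)) H := crosses_wall c.
by have := tw n; rewrite (coherent_same coh eW) eW e eqxx.
Qed.

(* Greedy construction: at each vertex, step along a shortest path across the
   first wall, in a fixed enumeration, that still separates it from [s]. *)
Lemma approach_ex s : coherent s -> (forall g, exists H, pside H g != s H) ->
  exists r a, approaches s r a.
Proof.
move=> coh nv.
pose code H : nat := pickle (word_of H.1, H.2).
have code_inj H K : code H = code K -> H = K.
  move/(pcan_inj pickleK) => [e1 e2]; rewrite [H]surjective_pairing [K]surjective_pairing e2.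
  by rewrite -(word_ofK H.1) e1 word_ofK.
pose least g H := pside H g != s H /\ forall K, pside K g != s K -> (code H <= code K)%N.
have least_ex g : exists H, least g H.
  have ex : exists n, `[< exists2 H, pside H g != s H & code H = n >].
    by have [H hH] := nv g; exists (code H); apply/asboolP; exists H.
  case: (ex_minnP ex) => n /asboolP[H hH <-] min; exists H; split=> // K hK.
  by apply: min; apply/asboolP; exists K.
have /choice[f hf] g : exists b, exists2 H, least g H & exists w, shortest_across H g (b :: w).
  have [H lH] := least_ex g.
  have [h hh] : exists h, pside H h != pside H g.
    have [h hh] := coh [:: H]; exists h; rewrite hh ?mem_head // eq_sym; exact: lH.1.
  have [[|b w] sw] := shortest_ex hh; last by exists b, H => //; exists w.
  by case: sw; rewrite ev_nil mulg1 eqxx.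
pose r n := iter n (fun g => g * letter (f g)) 1.
pose a n := f (r n).
have st n : r n.+1 = r n * letter (a n) by [].
have tw n : pside (wall_at (r n) (a n)) (r n) != s (wall_at (r n) (a n)).
  have [H [hH _] [w sw]] := hf (r n); set W := wall_at _ _.
  (* A vertex [q] realising [s] on both walls is beyond [H], hence by [shortest_walls] beyond the
     first wall met on a shortest path across [H]. *)
  have [q hq] := coh [:: H; W].
  rewrite -(hq W) ?inE ?eqxx ?orbT // eq_sym; apply: (shortest_walls sw).
    by rewrite /= (_ : crosses _ _ _) //; apply: crosses_at.
  by rewrite hq ?mem_head // eq_sym.
have stay m n H : (m <= n)%N -> pside H (r m) = s H -> pside H (r n) = s H.
  exact: toward_settled coh st tw.
have td : tends s r.
  suff td l : exists N, forall H, (code H < l)%N -> forall n, (N <= n)%N -> pside H (r n) = s H.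
    by move=> H; have [N hN] := td (code H).+1; exists N; apply: hN.
  elim: l => [|l [N hN]]; first by exists 0.
  have [[H Hc]|no] := pselect (exists H, code H = l); last first.
    exists N => H; rewrite ltnS leq_eqVlt => /predU1P[e|/hN //]; by case: no; exists H.
  suff [M NM hM] : exists2 M, (N <= M)%N & pside H (r M) = s H.
    exists M => K; rewrite ltnS leq_eqVlt => /predU1P[e|Kc] n Mn.
      by apply: stay Mn _; rewrite (code_inj K H) ?e.
    by apply: hN => //; apply: leq_trans Mn.
  (* Once all smaller codes are settled, each greedy step aims at [H] until it is crossed, and the
     length of a shortest path across [H] drops every time; [d] bounds this length. *)
  suff reach d m w : (N <= m)%N -> (size w <= d)%N -> pside H (r m * ev w) != pside H (r m) ->
      exists2 M, (N <= M)%N & pside H (r M) = s H.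
    have [e|ne] := eqVneq (pside H (r N)) (s H); first by exists N.
    have [h hh] := coh [:: H].
    apply: (reach _ N (word_of ((r N)^-1 * h)) (leqnn _) (leqnn _)).
    by rewrite word_ofK mulVKg hh ?mem_head // eq_sym.
  elim: d m w => [|d IH] m w Nm.
    by rewrite leqn0 => /nilP ->; rewrite ev_nil mulg1 eqxx.
  move=> wd hw; have [e|ne] := eqVneq (pside H (r m)) (s H); first by exists m.
  have [K [hK Kmin] [v sv]] := hf (r m).
  have KH : K = H.
    apply/code_inj/eqP; rewrite eqn_leq Kmin //= Hc leqNgt; apply/negP => /hN /(_ m Nm) e.
    by rewrite e eqxx in hK.
  rewrite KH in sv; case: sv => hv vmin.
  case cH: (crosses H (r m) (f (r m))).
    exists m.+1; first exact: leqW.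
    by rewrite st pside_letter cH; move: ne; case: pside; case: (s H).
  apply: (IH m.+1 v); first exact: leqW.
    by have := leq_trans (vmin _ hw) wd.
  by rewrite st pside_letter cH addbF -mulgA -ev_cons.
exists r, a; split=> // m n; case: ltnP => [nm|mn].
  apply/eqP/(stay n.+1 m) => //; rewrite st pside_letter crosses_at.
  by have := tw n; case: pside; case: (s _).
apply/negP => /eqP /(stay _ n _ mn) e; by have := tw n; rewrite e eqxx.
Qed.

End Rays.

(** * Hyperplanes and standard subcomplexes of the cover *)

Section Cells.
Local Open Scope group_scope.
Variable G : sgraph.
Implicit Types (x y z : G) (b : G * bool) (w : seq (G * bool)) (beta : bool).
Implicit Types (g h k p q : raag G) (H K W : wall G) (L : {set G}) (c d : clique G).
Local Notation cells := (cell (salvetti_cover G)).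
Implicit Types (e f : cells).

Definition mkcell g c : cells := (g, c).

Lemma is_clique0 : @is_clique G finset.set0.
Proof. by apply/'forall_implyP => x; rewrite inE. Qed.

Lemma is_clique1 x : is_clique [set x]%SET.
Proof.
apply/'forall_implyP => y /set1P ->; apply/'forall_implyP => z /set1P ->.
by rewrite eqxx.
Qed.

Lemma is_clique2 x y : adj x y -> is_clique [set x; y]%SET.
Proof.
move=> xy; apply/'forall_implyP => u /set2P[] ->; apply/'forall_implyP => v /set2P[] ->;
  by rewrite ?eqxx // ?xy ?implybT // adj_sym xy implybT.
Qed.

Definition clique0 : clique G := exist (@is_clique G) finset.set0 is_clique0.
Definition clique1 x : clique G := exist (@is_clique G) [set x]%SET (is_clique1 x).
Definition clique2 x y (xy : adj x y) : clique G :=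
  exist (@is_clique G) [set x; y]%SET (is_clique2 xy).

Definition vtx g : cells := mkcell g clique0.
Definition edge g x : cells := mkcell g (clique1 x).

Lemma vtx_inj : injective vtx.
Proof. by move=> g h []. Qed.

Lemma edge_inj g h x y : edge g x = edge h y -> g = h /\ x = y.
Proof. by case=> -> /finset.set1_inj. Qed.

Lemma mkcell_eq g c h d : g = h -> sval c = sval d -> mkcell g c = mkcell h d.
Proof. by move=> -> /val_inj ->. Qed.

Lemma dim0_vtx e : cube_dim e = 0 -> e = vtx e.1.
Proof.
by case: e => g c /= /eqP; rewrite cards_eq0 => /eqP c0; apply: mkcell_eq.
Qed.

Lemma dim_vtx g : cube_dim (vtx g) = 0.
Proof. by rewrite /= cards0. Qed.

Lemma dim1_edge e : cube_dim e = 1%N -> exists x, e = edge e.1 x.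
Proof.
by case: e => g c /= /eqP/cards1P[x cx]; exists x; apply: mkcell_eq.
Qed.

Lemma dim_edge g x : cube_dim (edge g x) = 1%N.
Proof. by rewrite /= cards1. Qed.

Definition edge_end g x beta : raag G := if beta then g * rgen x else g.

Lemma face_cell g c i beta : (i < #|sval c|)%N ->
  exists2 x, x \in sval c & face (mkcell g c) i beta = mkcell (edge_end g x beta) (clique_del c x).
Proof. by case/clique_enum => x xc xi; exists x => //=; rewrite /cover_face /= xi. Qed.

Lemma cell_face g c x : x \in sval c ->
  exists2 i, (i < #|sval c|)%N &
    forall beta, face (mkcell g c) i beta = mkcell (edge_end g x beta) (clique_del c x).
Proof.
move=> xc; exists (index x (enum (sval c))).
  by rewrite cardE index_mem mem_enum.
move=> beta; rewrite /= /cover_face /=.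
suff -> : onth (enum (sval c)) (index x (enum (sval c))) = Some x by [].
by rewrite onthE (nth_map x) ?nth_index ?index_mem ?mem_enum.
Qed.

Lemma face_edge g x beta : face (edge g x) 0 beta = vtx (edge_end g x beta).
Proof.
have [|y /set1P -> ->] := @face_cell g (clique1 x) 0 beta.
  by rewrite cards1.
by apply: mkcell_eq; rewrite //= finset.setDv.
Qed.

Lemma facetP g c h d : facet (mkcell h d) (mkcell g c) <->
  exists x beta, [/\ x \in sval c, sval d = (sval c :\ x)%SET & h = edge_end g x beta].
Proof.
split=> [[i [beta [/face_cell H e]]]|[x [beta [xc de ->]]]].
  have [x xc fe] := H g beta; rewrite fe in e; case: e => -> ->.
  by exists x, beta.
have [i ic fe] := cell_face g xc; exists i, beta; split=> //.
by rewrite fe; apply: mkcell_eq.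
Qed.

Lemma edge_face g b : joins (edge (edge_base g b) b.1) (vtx g) (vtx (g * letter b)).
Proof.
split; first exact: dim_edge.
exists (~~ b.2); rewrite !face_edge /edge_end /edge_base negbK -letter_rgen.
case: b => x [] //=; split=> //; rewrite -mulgA.
by rewrite (letterV (x, true)) mulVg mulg1.
Qed.

Lemma joinsP e g f : joins e (vtx g) f <->
  exists b, e = edge (edge_base g b) b.1 /\ f = vtx (g * letter b).
Proof.
split=> [[/dim1_edge[x ->] [beta []]]|[b [-> ->]]]; last exact: edge_face.
rewrite !face_edge; move: e.1 => h /vtx_inj ->; case: beta => -> /=.
  exists (x, false); rewrite /edge_base /= -letter_rgen (letterV (x, true)).
  by rewrite mulgK.
by exists (x, true).
Qed.

Lemma joins_vtx e u v : joins e u v -> exists g, u = vtx g.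
Proof.
case=> /dim1_edge[x ->] [beta [-> _]]; rewrite face_edge; by eexists.
Qed.

Lemma walkP n g f : walk n (vtx g) f <-> exists2 w, size w = n & f = vtx (g * ev w).
Proof.
elim: n g f => [|n IH] g f /=; split.
- by move=> <-; exists [::]; rewrite // ev_nil mulg1.
- by case=> w /size0nil -> ->; rewrite ev_nil mulg1.
- case=> u [e /joinsP[b [_ ->]]] /IH[w <- ->]; exists (b :: w) => //.
  by rewrite ev_cons mulgA.
- case=> -[//|b w] [sw ->]; exists (vtx (g * letter b)).
    by exists (edge (edge_base g b) b.1); exact: edge_face.
  by apply/IH; exists w; rewrite // ev_cons mulgA.
Qed.

(** * Hyperplanes and halfspaces of the cover in terms of walls *)

Definition hyp W : set cells := [set e | exists2 g, e = edge g W.2 & in_link W.2 (W.1^-1 * g)].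

Lemma hyp_edge W g x : hyp W (edge g x) <-> x = W.2 /\ in_link W.2 (W.1^-1 * g).
Proof.
split=> [[h /edge_inj[-> ->]]//|[-> h]]; by exists g.
Qed.

Lemma hyp_crosses W g b : hyp W (edge (edge_base g b) b.1) <-> crosses W g b.
Proof.
rewrite hyp_edge; split=> [[e h]|/andP[/eqP ? /asboolP]//].
by rewrite /crosses e eqxx; apply/asboolP.
Qed.

Lemma oppositeP e f : opposite e f <->
  exists g x y, [/\ adj x y, e = edge g x & f = edge (g * rgen y) x].
Proof.
split=> [[[h c] [i [/= c2 i2 -> ->]]]|[g [x [y [xy -> ->]]]]].
  have ic : (i < #|sval c|)%N by rewrite c2.
  have [y yc xi] := clique_enum ic.
  have := cardsD1 y (sval c); rewrite c2 yc => -[/esym/eqP/cards1P[x cx]].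
  have : x \in (sval c :\ y)%SET by rewrite cx finset.set11.
  rewrite finset.in_setD1 => /andP[xy xc].
  have /'forall_implyP/(_ x xc)/'forall_implyP/(_ y yc) := svalP c; rewrite xy /= => axy.
  exists h, x, y; split=> //; rewrite /cover_face /= xi; exact: mkcell_eq.
have ym : y \in sval (clique2 xy) by rewrite /= !inE eqxx orbT.
have [i ic fe] := cell_face g ym.
have xny : x != y by apply: (contraTneq _ xy) => ->; rewrite adj_irr.
have c2 : #|[set x; y]%SET| = 2 by rewrite cards2 xny.
have de : (sval (clique2 xy) :\ y)%SET = [set x]%SET.
  apply/setP => z; rewrite /= !inE; case: (eqVneq z y) => [->|_] /=; last by rewrite orbF.
  by rewrite eq_sym (negbTE xny).
exists (mkcell g (clique2 xy)), i; split.
- exact: c2.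
- by move: ic; rewrite /= c2.
- by rewrite fe; apply/esym/mkcell_eq.
- by rewrite fe; apply/esym/mkcell_eq.
Qed.

(** Passing to the opposite edge of a square multiplies the base by a generator of the link of [x]
    or its inverse, so the class sweeps out the coset of the link subgroup. *)
Lemma hyp_class g x : [set e | clos_refl_sym_trans _ (@opposite _) (edge g x) e] = hyp (g, x).
Proof.
apply/seteqP; split=> e /=.
  have inv u v : clos_refl_sym_trans _ (@opposite (salvetti_cover G)) u v ->
      hyp (g, x) u <-> hyp (g, x) v.
    elim=> {u v} [u v /oppositeP[h [y [z [yz -> ->]]]]|//|u v _ ->//|u v t _ -> _ ->//].
    have lz : in_link y (rgen z) by apply: (@in_link_letter _ _ (z, true)).
    rewrite !hyp_edge /= mulgA.
    by split=> -[yx hl]; split=> //; move: hl; rewrite -yx (in_linkMr _ lz).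
  move/inv => <-; apply/hyp_edge; split=> //=; rewrite mulVg; exact: in_link1.
case=> h -> [w /= xw]; rewrite -{2}(mulVKg g h) => ->.
elim/last_ind: w xw => [_|w b IH]; first by rewrite ev_nil mulg1; apply: rst_refl.
rewrite all_rcons => /andP[xb /IH {}IH]; apply: rst_trans IH _.
rewrite ev_rcons mulgA; move: (g * ev w) => p; case: b xb => y [] /= xy.
  by apply: rst_step; apply/oppositeP; exists p, x, y.
apply: rst_sym; apply: rst_step; apply/oppositeP; exists (p * letter (y, false)), x, y.
by split=> //; rewrite -letter_rgen (letterV (y, true)) mulgVK.
Qed.

Lemma hyperplaneP (S : set cells) : is_hyperplane S <-> exists W, S = hyp W.
Proof.
split=> [[e /dim1_edge[x ->] ->]|[[g x] ->]].
  by exists (e.1, x); rewrite -hyp_class.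
by exists (edge g x); rewrite ?dim_edge ?hyp_class.
Qed.

Definition halfset W beta : set cells := [set e | exists2 g, e = vtx g & pside W g = beta].

Lemma halfset_vtx W beta g : halfset W beta (vtx g) <-> pside W g = beta.
Proof. by split=> [[h /vtx_inj ->]//|?]; exists g. Qed.

Lemma side_hyp W g : side (hyp W) (vtx g) = halfset W (pside W g).
Proof.
apply/seteqP; split=> e /=.
  have inv u v : clos_refl_sym_trans _ (fun s t => exists2 e, joins e s t & ~ hyp W e) u v ->
      halfset W (pside W g) u <-> halfset W (pside W g) v.
    elim=> {u v} [u v [f j]|//|u v _ ->//|u v t _ -> _ ->//].
    have [p up] := joins_vtx j; rewrite up in j *.
    case/joinsP: j => b [-> ->]; rewrite hyp_crosses => /negP/negbTE nc.
    by rewrite !halfset_vtx pside_letter nc addbF.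
  by move/inv => <-; apply/halfset_vtx.
case=> h -> /esym/joinedP; elim=> {h} [p q [b -> nc]|p|p q _ |p q r _ h1 _ h2].
- apply: rst_step; exists (edge (edge_base p b) b.1); first exact: edge_face.
  by rewrite hyp_crosses; apply/negP.
- exact: rst_refl.
- exact: rst_sym.
- exact: rst_trans h1 h2.
Qed.

Lemma pside_surj W beta : exists g, pside W g = beta.
Proof.
case: beta; first by exists (W.1 * letter (W.2, true)); rewrite pside_top.
by exists W.1; rewrite pside_base.
Qed.

Lemma hyp_hyperplane W : is_hyperplane (hyp W).
Proof. by apply/hyperplaneP; exists W. Qed.

Lemma halfset_side W beta : exists2 u, cube_dim u = 0 & halfset W beta = side (hyp W) u.
Proof.
have [g <-] := pside_surj W beta; exists (vtx g); first exact: dim_vtx.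
by rewrite side_hyp.
Qed.

Definition wall_half W beta : halfspace (salvetti_cover G) :=
  Halfspace (hyp_hyperplane W) (halfset_side W beta).

Lemma halfspaceP (h : halfspace (salvetti_cover G)) :
  exists W beta, bdry h = hyp W /\ hset h = halfset W beta.
Proof.
case: h => S A /= hS [u /dim0_vtx -> ->]; case/hyperplaneP: (hS) => W ->.
by exists W, (pside W u.1); rewrite side_hyp.
Qed.

(** The corner of a face moves only along dropped directions. Since the labels of a cube are
    pairwise adjacent, such letters lie in the link of every remaining direction, as [face_in_hyp]
    requires. *)
Lemma is_faceP g c h d : is_face (mkcell h d) (mkcell g c) -> (sval d \subset sval c) /\
  exists2 w, all (fun b => (b.1 \in sval c) && (b.1 \notin sval d)) w & h = g * ev w.
Proof.
move=> fc.
suff : forall e f, is_face e f -> (sval e.2 \subset sval f.2) /\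
  exists2 w, all (fun b => (b.1 \in sval f.2) && (b.1 \notin sval e.2)) w & e.1 = f.1 * ev w.
  by move=> /(_ _ _ fc).
move=> {g c h d fc} e f.
elim=> {e f} [[h d] [g c] /facetP[x [beta [xc de ->]]]|e|e f t _ [s1 [w1 h1 e1]] _ [s2 [w2 h2 e2]]].
- rewrite /= de finset.subD1set; split=> //.
  case: beta; last by exists [::]; rewrite ?ev_nil ?mulg1.
  by exists [:: (x, true)] => //=; rewrite xc !inE eqxx.
- by split=> //; exists [::]; rewrite ?ev_nil ?mulg1.
- split; first exact: fintype.subset_trans s2.
  exists (w2 ++ w1); last by rewrite ev_cat mulgA -e2.
  rewrite all_cat; apply/andP; split.
    apply: sub_all h2 => b /andP[-> /=]; apply: contra; exact: (fintype.subsetP s1).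
  by apply: sub_all h1 => b /andP[/(fintype.subsetP s2) ->].
Qed.

Lemma face_in_hyp W e g c : is_face e (mkcell g c) -> hyp W e ->
  in_link W.2 (W.1^-1 * g).
Proof.
move=> fe [h eE hl]; rewrite eE in fe; have [sc [w hw he]] := is_faceP fe.
suff lw : in_link W.2 (ev w) by move: hl; rewrite he mulgA (in_linkMr _ lw).
exists w => //; apply: sub_all hw => b /andP[bc]; rewrite !inE => bW.
have Wc : W.2 \in sval c by apply: (fintype.subsetP sc); rewrite /= inE.
have /'forall_implyP/(_ _ Wc)/'forall_implyP/(_ _ bc) := svalP c.
by rewrite eq_sym bW.
Qed.

Lemma intersects_hyp W K : intersects (hyp W) (hyp K) ->
  exists2 g, in_link W.2 (W.1^-1 * g) & crosses K g (K.2, true).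
Proof.
case=> -[g c] [e [f [fe ff he hf]]]; exists g; first exact: face_in_hyp fe he.
by rewrite /crosses eqxx; apply/asboolP; apply: face_in_hyp ff hf.
Qed.

(** * Standard subcomplexes as cosets of the subgroups generated by sets of vertices *)

Definition standard_at L g : set cells :=
  [set e : cells | agree_off L g e.1 /\ sval (e.2 : clique G) \subset L].

Lemma agree_off_trans L g h k : agree_off L g h -> agree_off L h k -> agree_off L g k.
Proof. by move=> gh hk H HL; rewrite gh // hk. Qed.

Lemma agree_off_sym L g h : agree_off L g h -> agree_off L h g.
Proof. by move=> gh H HL; rewrite gh. Qed.

Lemma agree_off_letter L g b : b.1 \in L -> agree_off L g (g * letter b).
Proof. by move=> bL; apply/agree_offP; exists [:: b]; rewrite //= bL. Qed.

(** Facets stay within a coset. Conversely each cell is connected to its initial corner by dropping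
    its directions one at a time, and corners of one coset are connected along a word in [L]. *)
Lemma standard_component L g c : sval c \subset L ->
  component_in (@covering_map G @^-1` salvetti_sub L) (mkcell g c) = standard_at L g.
Proof.
move=> cL; pose Z := @covering_map G @^-1` salvetti_sub L.
pose conn := clos_refl_sym_trans cells (fun e f => [/\ Z e, Z f & facet e f]).
apply/seteqP; split=> e /=.
  have inv u v : conn u v -> standard_at L g u <-> standard_at L g v.
    elim=> {u v} [[h1 d1] [h2 d2] [z1 z2 facet12]|//|u v _ ->//|u v t _ -> _ ->//].
    have [x [beta [xd _ ->]]] := (facetP _ _ _ _).1 facet12.
    have xL : x \in L by apply: (fintype.subsetP z2).
    have h12 : agree_off L h2 (edge_end h2 x beta).
      by case: beta => //; apply: (@agree_off_letter _ _ (x, true)).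
    split=> -[/= a1 _]; split=> //; first exact: agree_off_trans a1 (agree_off_sym h12).
    exact: agree_off_trans a1 h12.
  by move/inv => <-; split.
have to_vtx h d : sval d \subset L -> conn (mkcell h d) (vtx h).
  move: {2}#|sval d| (erefl #|sval d|) => n; elim: n d => [|n IH] d dn dL.
    move/eqP: dn; rewrite cards_eq0 => /eqP d0.
    have -> : mkcell h d = vtx h by apply: mkcell_eq.
    exact: rst_refl.
  have /card_gt0P[x xd] : (0 < #|sval d|)%N by rewrite dn.
  have dxL : sval (clique_del d x) \subset L.
    exact: fintype.subset_trans (finset.subD1set _ _) dL.
  apply: rst_trans (IH (clique_del d x) _ dxL); last first.
    by have := cardsD1 x (sval d); rewrite dn xd => -[].
  apply: rst_sym; apply: rst_step; split=> //.
  by apply/facetP; exists x, false.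
have step p b : b.1 \in L -> conn (vtx p) (vtx (p * letter b)).
  move=> bL; have eL : sval (clique1 b.1) \subset L.
    by rewrite finset.sub1set.
  have zv q : Z (vtx q) by apply: finset.sub0set.
  have ends beta : conn (vtx (edge_end (edge_base p b) b.1 beta)) (edge (edge_base p b) b.1).
    apply: rst_step; split=> //; apply/facetP; exists b.1, beta.
    by rewrite /= finset.set11 finset.setDv.
  have [_ [beta []]] := edge_face p b.
  rewrite !face_edge => -> ->; apply: rst_trans (ends beta) _; apply: rst_sym; exact: ends.
case: e => h d [/= /agree_offP[w wL ->] dL].
apply: rst_trans (to_vtx g c cL) _; apply: rst_trans (rst_sym _ _ _ _ (to_vtx _ d dL)).
elim: w g wL {c cL} => [|b w IH] g /=; first by rewrite ev_nil mulg1 => _; apply: rst_refl.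
case/andP=> bL wL; rewrite ev_cons mulgA; apply: rst_trans (IH _ wL); exact: step.
Qed.

Lemma standard_typeP L (Y : set cells) : standard_of_type L Y <-> exists g, Y = standard_at L g.
Proof.
split=> [[[g c] cL ->]|[g ->]]; first by exists g; rewrite -(standard_component g cL).
have vL : sval (vtx g).2 \subset L by apply: finset.sub0set.
by exists (vtx g) => //; rewrite (standard_component g vL).
Qed.

End Cells.

(** * The Roller boundary *)

Section Topology.
Variable X : cube_complex.
Implicit Types (xi : orientation X) (h : halfspace X).

Lemma eval_continuous h : continuous (fun xi => xi h).
Proof.
move=> xi; have /cvg_sup/(_ h) hc : xi --> xi by apply: cvg_id.
apply: cvg_trans; last first.
  exact: (@initial_continuous _ _ (fun xi : orientation X => xi h) xi).
by move=> A hA; apply: hc.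
Qed.

Lemma open_eval h (beta : bool) : open [set xi : orientation X | xi h = beta].
Proof.
have /continuousP c := @eval_continuous h.
exact: (c [set beta] (discrete_open _)).
Qed.

Lemma reindex_continuous (F : halfspace X -> halfspace X) :
  continuous (fun xi : orientation X => (fun h => xi (F h)) : orientation X).
Proof.
move=> xi; apply/cvg_sup => h A [_ [[B oB <-] Bx] sBA].
have nB : nbhs (xi (F h)) B by apply: open_nbhs_nbhs.
have nxi : nbhs xi ((fun eta : orientation X => eta (F h)) @^-1` B).
  exact: eval_continuous nB.
suff : nbhs xi ((fun eta : orientation X => (fun k => eta (F k)) : orientation X) @^-1` A) by [].
by move: nxi; apply: filterS => eta Be; apply: sBA.
Qed.

End Topology.

Section Boundary.
Local Open Scope group_scope.
Variable G : sgraph.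
Local Notation X := (salvetti_cover G).
Implicit Types (x y z : G) (b : G * bool) (w : seq (G * bool)) (beta : bool).
Implicit Types (g p q : raag G) (H K W : wall G) (L : {set G}) (c d : clique G).
Implicit Types (xi : orientation X) (h : halfspace X) (e f : cell X).

(** * Points of the closure as choices of sides of walls *)

Definition vertex_orientations : set (orientation X) :=
  [set vertex_orientation v | v in [set v : cell X | cube_dim v = 0]].

Lemma closure_near xi (P : set (orientation X)) : closure vertex_orientations xi ->
  nbhs xi P -> exists g, P (vertex_orientation (vtx g)).
Proof.
move=> cl nP; have [_ [[v /dim0_vtx -> <-] Pv]] := cl _ nP; by exists v.1.
Qed.

Lemma closure_agree xi (hs : seq (halfspace X)) : closure vertex_orientations xi ->
  exists g, foldr (fun h P => xi h = `[< hset h (vtx g) >] /\ P) True hs.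
Proof.
move=> cl.
apply: (closure_near (P := fun eta => foldr (fun h P => xi h = eta h /\ P) True hs) cl).
elim: hs => [|h hs IH] /=; first exact: filterT.
have nh : nbhs xi [set eta : orientation X | eta h = xi h].
  by apply: open_nbhs_nbhs; split=> //; apply: open_eval.
apply: (@filterS2 _ (nbhs xi) (nbhs_filter xi) _ _ _ _ nh IH) => eta /= etah IHeta.
by split.
Qed.

Definition wall_side xi W : bool := xi (wall_half W true).

(** The relation involves only two coordinates and holds at vertices, so it passes to the closure.
    Hence a point of the closure is determined by [wall_side]. *)
Lemma eval_halfset xi h W beta : closure vertex_orientations xi ->
  hset h = halfset W beta -> xi h = (wall_side xi W == beta).
Proof.
move=> cl hW; have [g /= [-> [e _]]] := closure_agree [:: h; wall_half W true] cl.
rewrite /wall_side e hW /=; apply/asboolP/eqP => [/halfset_vtx wb|].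
  case: beta wb {hW} => wb; first by apply/asboolP/halfset_vtx.
  by apply/asboolP => /halfset_vtx; rewrite wb.
move=> <-; apply/halfset_vtx; case: asboolP => [/halfset_vtx //|/halfset_vtx].
by case: pside.
Qed.

Lemma eval_hset xi h h' : closure vertex_orientations xi -> hset h = hset h' -> xi h = xi h'.
Proof.
move=> cl hh; have [W [beta [_ hW]]] := halfspaceP h.
by rewrite (eval_halfset cl hW) (eval_halfset cl (etrans (esym hh) hW)).
Qed.

Lemma wall_side_coherent xi : closure vertex_orientations xi -> coherent (wall_side xi).
Proof.
move=> cl Hs; have [g hg] := closure_agree [seq wall_half W true | W <- Hs] cl.
exists g; elim: Hs hg => [//|W Hs IH] /= [e /IH {}IH] K.
rewrite inE => /predU1P[->|/IH //]; rewrite /wall_side e.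
apply/idP/asboolP => [sW|/halfset_vtx //]; exact/halfset_vtx.
Qed.

Lemma wall_side_vertex xi g : closure vertex_orientations xi ->
  (forall W, pside W g = wall_side xi W) -> xi = vertex_orientation (vtx g).
Proof.
move=> cl hg; apply/funext => h; have [W [beta [_ hW]]] := halfspaceP h.
rewrite (eval_halfset cl hW) -hg /vertex_orientation hW.
by apply/eqP/asboolP => /halfset_vtx.
Qed.

Lemma boundary_not_vertex xi : roller_boundary xi ->
  forall g, exists W, pside W g != wall_side xi W.
Proof.
move=> [cl nv] g; apply: contrapT => no; apply: nv; exists (vtx g); first exact: dim_vtx.
apply/esym/wall_side_vertex => // W; apply/eqP/negPn/negP => ne.
by apply: no; exists W.
Qed.

Lemma represents_tends xi (r : nat -> raag G) : closure vertex_orientations xi ->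
  represents (fun n => vtx (r n)) xi <-> tends (wall_side xi) r.
Proof.
move=> cl; split=> [rep W|td h].
  have : xi (wall_half W (wall_side xi W)).
    by rewrite (eval_halfset cl (W := W) (beta := wall_side xi W)).
  by case/rep => N hN; exists N => n /hN /halfset_vtx.
have [W [beta [_ hW]]] := halfspaceP h; have [N hN] := td W.
rewrite (eval_halfset cl hW) hW; split=> [/eqP <-|[M hM]].
  by exists N => n /hN hn; apply/halfset_vtx.
apply/eqP; rewrite -(hN (maxn N M)) ?leq_maxl //.
by apply/halfset_vtx; apply: hM; rewrite leq_maxr.
Qed.

(** * Geodesic rays as sequences of letters *)

Lemma geodesic_letters (r : nat -> cell X) : geodesic_ray r ->
  exists (s : nat -> raag G) (a : nat -> G * bool),
  [/\ r = (fun n => vtx (s n)), forall n, s n.+1 = s n * letter (a n)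
    & forall m n w, (m <= n)%N -> s n = s m * ev w -> (n - m <= size w)%N].
Proof.
case=> r0 geo; pose s n : raag G := (r n).1.
have rs n : r n = vtx (s n) by apply/dim0_vtx/r0.
have /choice[a ha] n : exists b, s n.+1 = s n * letter b.
  have [/= + _] := geo n n.+1 (leqnSn n).
  rewrite subSnn !rs => -[u [e /joinsP[b [_ ->]]]] /= /vtx_inj <-.
  by exists b.
exists s, a; split=> //; first exact/funext.
move=> m n w mn e; have [_ min] := geo m n mn; apply: min.
by rewrite !rs; apply/walkP; exists w; rewrite // e.
Qed.

Lemma approaches_geodesic t (r : nat -> raag G) (a : nat -> G * bool) :
  approaches t r a -> geodesic_ray (fun n => vtx (r n)).
Proof.
move=> ap; split=> [n|m n mn]; first exact: dim_vtx.
have e := ray_seg (approach_step ap) m (n - m); rewrite subnKC // in e.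
split; first by apply/walkP; exists (seg a m (n - m)); rewrite ?size_mkseq ?e.
move=> k /walkP[w <- /vtx_inj en].
by apply: (ray_crosses_all ap en (erefl _)); rewrite subnKC.
Qed.

Lemma geodesic_approach xi (r : nat -> cell X) : closure vertex_orientations xi ->
  geodesic_ray r -> represents r xi ->
  exists (s : nat -> raag G) (a : nat -> G * bool),
    r = (fun n => vtx (s n)) /\ approaches (wall_side xi) s a.
Proof.
move=> cl /geodesic_letters[s [a [-> st geo]]] /(represents_tends _ cl) td.
by exists s, a; split=> //; apply: geodesic_approaches.
Qed.

Lemma boundary_approach xi : roller_boundary xi ->
  exists (s : nat -> raag G) (a : nat -> G * bool), approaches (wall_side xi) s a.
Proof.
move=> bd; apply: approach_ex (boundary_not_vertex bd).
by apply: wall_side_coherent; case: bd.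
Qed.

(** The base of the [n]-th edge is [r n] or [r n.+1]; these differ by a letter of [L], so either may
    be tested for membership in the coset. *)
Lemma subray_standard t (r : nat -> raag G) (a : nat -> G * bool) L g :
  approaches t r a -> contains_subray (fun n => vtx (r n)) (standard_at L g) <->
  exists N, forall n, (N <= n)%N -> agree_off L g (r n) /\ (a n).1 \in L.
Proof.
move=> ap; have st := approach_step ap; split=> -[N hN]; exists N => n Nn.
  have [e /joinsP[b [-> /vtx_inj rb]] [/= agb bL]] := hN n Nn.
  rewrite finset.sub1set in bL.
  (* Both letters lead from [r n] to [r n.+1], so they cross the same wall and share its label. *)
  have -> : (a n).1 = b.1.
    have : crosses (wall_at (r n) (a n)) (r n) b.
      by rewrite crossesE -rb st -crossesE crosses_at.
    by move/crosses_label => ->.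
  split=> //; move: agb; rewrite /edge_base; case: b.2 => // agb.
  exact: agree_off_trans agb (agree_off_sym (agree_off_letter _ bL)).
have [ag aL] := hN n Nn; exists (edge (edge_base (r n) (a n)) (a n).1).
  by rewrite st; apply: edge_face.
split; last by rewrite /= finset.sub1set.
rewrite /= /edge_base; case: (a n).2 => //.
exact: agree_off_trans ag (agree_off_letter _ aL).
Qed.

(** Defined from the sides of [xi] alone, without choosing a ray, which is what makes equivariance
    and measurability accessible. *)
Definition core_complex xi : set (cell X) :=
  [set e : cell X | exists L, core (wall_side xi) L e.1 /\ sval (e.2 : clique G) \subset L].

(** Minimality applied both ways leaves one possible type, so the union over [L] reduces to a single
    coset. *)
Lemma core_complexE xi L g : core (wall_side xi) L g -> core_complex xi = standard_at L g.
Proof.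
move=> [sg ming]; apply/seteqP; split=> e.
  case=> L' [[se mine] eL'].
  have LE : L' = L.
    by apply/eqP; rewrite finset.eqEsubset (mine _ _ sg) (ming _ _ se).
  rewrite {}LE in se eL' *; split=> // H HL; by rewrite sg // se.
case=> ag eL; exists L; split=> //; split=> // H HL.
by rewrite -ag // sg.
Qed.

Lemma core_complex_smallest xi (r : nat -> raag G) (a : nat -> G * bool) :
  approaches (wall_side xi) r a -> smallest_standard (fun n => vtx (r n)) (core_complex xi).
Proof.
move=> ap; have [N hN] := core_tail ap; have [cN _] := hN N (leqnn N).
have cE := core_complexE cN; split.
- by exists (recurrent a); apply/standard_typeP; exists (r N); rewrite cE.
- rewrite cE; apply/(subray_standard _ _ ap); exists N => n /hN[cn an]; split=> // H HL.
  by rewrite cN.1 // cn.1.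
move=> Z [L /standard_typeP[g ->]] /(subray_standard _ _ ap)[M hM].
have aL n : (M <= n)%N -> (a n).1 \in L by move/hM => [].
have sM n : (M <= n)%N -> settled (wall_side xi) L (r n) by apply: (settled_tail ap aL).
have RL : recurrent a \subset L by apply: (recurrent_min ap (sM M (leqnn _))).
rewrite cE => e [ag eR]; split; last exact: fintype.subset_trans eR RL.
move=> H HL; have HR : H.2 \notin recurrent a.
  by apply: contra HL; apply: (fintype.subsetP RL).
rewrite -ag // cN.1 // -(sM M) //; exact: (hM M (leqnn _)).1.
Qed.

(** Uniqueness rests on the existence of a representing ray: two subcomplexes that are smallest for
    the same ray contain each other. *)
Lemma core_complex_carrier xi : roller_boundary xi -> unique (carrier xi) (core_complex xi).
Proof.
move=> bd; have cl := bd.1; have [s [a ap]] := boundary_approach bd.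
have small := core_complex_smallest ap; split.
  split=> [|r geo rep]; first by case: small.
  by have [s' [a' [-> ap']]] := geodesic_approach cl geo rep; apply: core_complex_smallest ap'.
move=> Y [_ hY]; have := hY (fun n => vtx (s n)) (approaches_geodesic ap).
have rep : represents (fun n => vtx (s n)) xi.
  by apply/represents_tends => //; apply: approach_tends ap.
move=> /(_ rep)[sY cY minY]; case: small => sC cC minC.
by apply/seteqP; split; [apply: minC|apply: minY].
Qed.

Lemma core_ex xi : roller_boundary xi -> exists L g, core (wall_side xi) L g.
Proof.
move=> /boundary_approach[s [a ap]]; have [N hN] := core_tail ap.
by exists (recurrent a), (s N); case: (hN N (leqnn N)).
Qed.

(** By [separated_eventually] the late walls of the ray are strongly separated from any given wall,
    and one late wall serves for both halfspaces. *)
Lemma regular_of_no_join xi (r : nat -> raag G) (a : nat -> G * bool) :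
  roller_boundary xi -> approaches (wall_side xi) r a -> ~ is_join (recurrent a) ->
  (forall y, exists2 z, z \in recurrent a & ~~ adj y z) -> regular_point xi.
Proof.
move=> [cl _] ap nj nadj h1 h2.
have sep_half h : xi h -> exists N, forall m, (N <= m)%N ->
    halfset (wall_at (r m) (a m)) (wall_side xi (wall_at (r m) (a m))) `<=` hset h /\
    strongly_separated (hyp (wall_at (r m) (a m))) (bdry h).
  have [W [beta [bh hh]]] := halfspaceP h.
  rewrite (eval_halfset cl hh) => /eqP sW.
  have nW : exists2 x, x \in recurrent a & ~~ adj x W.2.
    by have [z zr nz] := nadj W.2; exists z; rewrite // adj_sym.
  have [N hN] := separated_eventually ap nj nW; exists N => m /hN[inW sepW]; split.
    by rewrite hh => _ [q -> qm]; apply/halfset_vtx; rewrite -sW; apply: inW.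
  case=> S [/hyperplaneP[K ->]]; rewrite bh => /intersects_hyp[p lp cp] /intersects_hyp[q lq cq].
  have [z zr] := nadj K.2.
  (* The places [q] and [p] where [K] meets the two walls differ by an element of the link of [K.2],
     which would make [K.2] adjacent to every recurrent label. *)
  have lqp : in_link K.2 (q^-1 * p).
    have -> : q^-1 * p = (K.1^-1 * q)^-1 * (K.1^-1 * p) by rewrite invgM invgK -mulgA mulVKg.
    by apply: in_linkM => //; apply: in_linkV.
  by rewrite (sepW _ _ _ _ _ cq cp lqp).
move=> /sep_half[N1 hN1] /sep_half[N2 hN2]; pose m := maxn N1 N2.
have [in1 s1] := hN1 m (leq_maxl _ _); have [in2 s2] := hN2 m (leq_maxr _ _).
exists (wall_half (wall_at (r m) (a m)) (wall_side xi (wall_at (r m) (a m)))); split=> //.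
  by rewrite (eval_halfset cl (W := wall_at (r m) (a m)) (beta := wall_side xi (wall_at (r m) (a m)))).
by move=> e ee; split; [apply: in1|apply: in2].
Qed.

Lemma core_complex_join xi : nonregular xi -> exists L Z,
  [/\ standard_of_type L Z, is_join L & core_complex xi `<=` Z].
Proof.
move=> [bd nreg]; have [r [a ap]] := boundary_approach bd.
have [N hN] := core_tail ap; have [cN aN] := hN N (leqnn N).
suff [L [RL jL]] : exists L, recurrent a \subset L /\ is_join L.
  exists L, (standard_at L (r N)); split=> //; first by apply/standard_typeP; exists (r N).
  rewrite (core_complexE cN) => e [ag eR]; split; last exact: fintype.subset_trans eR RL.
  by move=> H HL; apply: ag; apply: contra HL; apply: (fintype.subsetP RL).
have [jR|nj] := pselect (is_join (recurrent a)); first by exists (recurrent a).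
have [y hy] : exists y, {in recurrent a, forall z, adj y z}.
  apply: contrapT => no; apply: nreg; apply: regular_of_no_join bd ap nj _ => y.
  apply: contrapT => ny; apply: no; exists y => z zr; apply: contrapT => /negP nyz.
  by apply: ny; exists z.
(* The vertex [y] is adjacent to all recurrent labels and so is not one of them; coning off by [y]
   gives a join. *)
exists (y |: recurrent a)%SET; split; first exact: finset.subsetUr.
have yR : y \notin recurrent a by apply/negP => /hy; rewrite adj_irr.
exists [set y]%SET, (recurrent a); split=> //.
- by apply/set0Pn; exists y; rewrite finset.set11.
- by apply/set0Pn; exists (a N).1.
- by apply/eqP; rewrite finset.setI_eq0 finset.disjoints1.
- by move=> x z /set1P -> /hy.
Qed.

End Boundary.

(** * Equivariance and measurability *)

Section Equivariance.
Local Open Scope group_scope.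
Variable G : sgraph.
Local Notation X := (salvetti_cover G).
Implicit Types (beta : bool) (g p q : raag G) (H K W : wall G) (L : {set G}).
Implicit Types (xi : orientation X) (h : halfspace X) (e f : cell X) (S : set (cell X)).

Lemma translateM g p e : translate g (translate p e) = translate (g * p) e.
Proof. by rewrite /translate /= mulgA. Qed.

Lemma translate1 e : translate 1 e = e.
Proof. by case: e => p c; rewrite /translate /= mul1g. Qed.

Lemma image_translateM g p S : translate g @` (translate p @` S) = translate (g * p) @` S.
Proof.
apply/seteqP; split=> u /=.
  by case=> _ [e Se <-] <-; exists e; rewrite ?translateM.
by case=> e Se <-; exists (translate p e); rewrite ?translateM //; exists e.
Qed.

Lemma image_translate1 S : translate 1 @` S = S.
Proof.
apply/seteqP; split=> e /=; first by case=> f Sf <-; rewrite translate1.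
by move=> Se; exists e; rewrite ?translate1.
Qed.

Definition translate_wall g W : wall G := (g * W.1, W.2).

Lemma translate_hyp g W : translate g @` hyp W = hyp (translate_wall g W).
Proof.
apply/seteqP; split=> u /=.
  case=> _ [p -> hp] <-; exists (g * p) => //=.
  by rewrite invgM -mulgA mulKg.
case=> p -> /=; rewrite invgM -mulgA => hp; exists (edge (g^-1 * p) W.2).
  by exists (g^-1 * p).
by rewrite /translate /= mulVKg.
Qed.

Lemma translate_halfset g W beta :
  translate g @` halfset W beta = halfset (translate_wall g W) beta.
Proof.
apply/seteqP; split=> u /=.
  by case=> _ [p -> hp] <-; exists (g * p) => //; rewrite pside_mul.
case=> p -> hp; exists (vtx (g^-1 * p)); last by rewrite /translate /= mulVKg.
by apply/halfset_vtx; rewrite -(pside_mul g) mulVKg.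
Qed.

Lemma translate_hyperplane g S : is_hyperplane S -> is_hyperplane (translate g @` S).
Proof. by move=> /hyperplaneP[W ->]; rewrite translate_hyp; apply: hyp_hyperplane. Qed.

Lemma translate_side g h :
  exists2 u, cube_dim u = 0 & translate g @` hset h = side (translate g @` bdry h) u.
Proof.
have [W [beta [-> ->]]] := halfspaceP h.
by rewrite translate_hyp translate_halfset; apply: halfset_side.
Qed.

Definition translate_halfspace g h : halfspace X :=
  Halfspace (translate_hyperplane g (bdry_hyperplane h)) (translate_side g h).

Lemma translate_facet g e f : facet e f -> facet (translate g e) (translate g f).
Proof. by case=> i [beta [lt ->]]; exists i, beta; rewrite translate_face. Qed.

Lemma translate_is_face g e f : is_face e f -> is_face (translate g e) (translate g f).
Proof.
elim=> {e f} [e f ef|e|e f u _ h1 _ h2]; [|exact: rt_refl|exact: rt_trans h1 h2].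
by apply: rt_step; apply: translate_facet.
Qed.

Lemma translate_intersects g S T :
  intersects S T -> intersects (translate g @` S) (translate g @` T).
Proof.
case=> c [e [f [ec fc Se Tf]]]; exists (translate g c), (translate g e), (translate g f).
by split; [exact: translate_is_face|exact: translate_is_face|exists e|exists f].
Qed.

(** The action as a reindexing of coordinates, continuous by [reindex_continuous]. It agrees with
    [push] on the closure, where a value depends only on the vertex set of the halfspace. *)
Definition shift g xi : orientation X := fun h => xi (translate_halfspace g^-1 h).

Lemma push_shift g xi : closure (@vertex_orientations G) xi -> push (translate g) xi = shift g xi.
Proof.
move=> cl; apply/funext => h; apply/asboolP/idP => [[k xk hk]|xh].
  by rewrite /shift (eval_hset cl (h' := k)) //= hk image_translateM mulVg image_translate1.
exists (translate_halfspace g^-1 h) => //=.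
by rewrite image_translateM mulgV image_translate1.
Qed.

Lemma shift_vertex g p : shift g (vertex_orientation (vtx p)) = vertex_orientation (vtx (g * p)).
Proof.
apply/funext => h; rewrite /shift /vertex_orientation /=; apply: asbool_equiv_eq; split.
  by case=> e he eE; suff <- : e = vtx (g * p) by []; move: eE => /(congr1 (translate g));
    rewrite translateM mulgV translate1.
by move=> hp; exists (vtx (g * p)) => //; rewrite /translate /= mulKg.
Qed.

Lemma shift_closure g xi : closure (@vertex_orientations G) xi ->
  closure (@vertex_orientations G) (shift g xi).
Proof.
move=> cl B nB.
have [p Bp] := closure_near cl (@reindex_continuous _ (translate_halfspace g^-1) xi _ nB).
exists (vertex_orientation (vtx (g * p))); split; last by rewrite -shift_vertex.
by exists (vtx (g * p)) => //; apply: dim_vtx.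
Qed.

Lemma wall_side_shift g xi W : closure (@vertex_orientations G) xi ->
  wall_side (shift g xi) W = wall_side xi (translate_wall g^-1 W).
Proof.
move=> cl; rewrite /wall_side /shift; apply: eval_hset => //=.
exact: translate_halfset.
Qed.

Lemma pside_translate g W p : pside (translate_wall g^-1 W) p = pside W (g * p).
Proof. by rewrite -(pside_mul g) /translate_wall /= mulVKg; case: W. Qed.

Lemma settled_shift g xi L p : closure (@vertex_orientations G) xi ->
  settled (wall_side (shift g xi)) L (g * p) <-> settled (wall_side xi) L p.
Proof.
move=> cl; split=> sp W WL; last first.
  by rewrite wall_side_shift // -(sp (translate_wall g^-1 W)) // pside_translate.
have := sp (translate_wall g W) WL.
rewrite wall_side_shift // -pside_translate.
have -> // : translate_wall g^-1 (translate_wall g W) = W.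
by case: W {WL} => k x; rewrite /translate_wall /= mulKg.
Qed.

Lemma core_shift g xi L p : closure (@vertex_orientations G) xi ->
  core (wall_side xi) L p -> core (wall_side (shift g xi)) L (g * p).
Proof.
move=> cl [sp min]; split=> [|L' q]; first exact/settled_shift.
by rewrite -(mulVKg g q) settled_shift // => /min.
Qed.

Lemma shift_boundary g xi : roller_boundary xi -> roller_boundary (shift g xi).
Proof.
move=> bd; have cl := bd.1; split; first exact: shift_closure.
case=> v /dim0_vtx -> e.
have [W /negP] := boundary_not_vertex bd (g^-1 * v.1); apply; apply/eqP.
have W' : translate_wall g^-1 (translate_wall g W) = W.
  by case: W => k x; rewrite /translate_wall /= mulKg.
rewrite -[in RHS]W' -wall_side_shift // -e -[in LHS]W' pside_translate mulVKg.
rewrite /wall_side /vertex_orientation /=.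
by apply/idP/asboolP => [?|/halfset_vtx //]; apply/halfset_vtx.
Qed.

(** Used contrapositively, to see that translates of non-regular points are non-regular: a witness
    found for the translated halfspaces is moved back by [g^-1]. *)
Lemma regular_shift g xi : closure (@vertex_orientations G) xi ->
  regular_point (shift g xi) -> regular_point xi.
Proof.
move=> cl reg h1 h2 x1 x2.
have sh h : xi h -> shift g xi (translate_halfspace g h).
  move=> xh; rewrite /shift (eval_hset cl (h' := h)) //=.
  by rewrite image_translateM mulVg image_translate1.
have [k [xk kin s1 s2]] := reg _ _ (sh _ x1) (sh _ x2).
have sep h : strongly_separated (bdry k) (translate g @` bdry h) ->
    strongly_separated (translate g^-1 @` bdry k) (bdry h).
  move=> s [S [hS Sk Sh]]; apply: s; exists (translate g @` S); split.
  - exact: translate_hyperplane.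
  - have := translate_intersects g Sk.
    by rewrite image_translateM mulgV image_translate1.
  - exact: translate_intersects.
exists (translate_halfspace g^-1 k); split=> //=; [|exact: sep|exact: sep].
have back h : translate g^-1 @` (translate g @` hset h) = hset h.
  by rewrite image_translateM mulVg image_translate1.
move=> _ [e /kin[/= e1 e2] <-].
by split; rewrite -[hset _]back; exists e.
Qed.

Lemma core_complex_equivariant g xi : nonregular xi ->
  nonregular (push (translate g) xi) /\
  core_complex (push (translate g) xi) = translate g @` core_complex xi.
Proof.
move=> [bd nreg]; have cl := bd.1; rewrite push_shift //; split.
  by split; [exact: shift_boundary|move/(regular_shift cl)].
have [L [p cp]] := core_ex bd.
rewrite (core_complexE cp) (core_complexE (core_shift g cl cp)).
have agree q1 q2 k : agree_off L q1 q2 -> agree_off L (k * q1) (k * q2).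
  move=> a W WL; have := a (translate_wall k^-1 W) WL.
  by rewrite !pside_translate.
apply/seteqP; split=> e /=.
  case=> a eL; exists (translate g^-1 e); last by rewrite translateM mulgV translate1.
  by split=> //=; rewrite -(mulKg g p); apply: agree.
by case=> f [/= a fL] <-; split=> //=; apply: agree.
Qed.

End Equivariance.

(** * Measurability of the assignment *)

Section Measurability.

Lemma sigma_algebra_countable_bigcup (T : Type) (D : set T) (B : set (set T))
    (I : countType) (F : I -> set T) :
  (forall i, <<s D, B>> (F i)) -> <<s D, B>> (\bigcup_i F i).
Proof.
move=> mF.
have -> : \bigcup_i F i = \bigcup_n (if unpickle n is Some i then F i else set0).
  apply/seteqP; split=> t [].
    by move=> i _ Ft; exists (pickle i); rewrite ?pickleK.
  by move=> n _; case: unpickle => // i Ft; exists i.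
apply: sigma_algebra_bigcup => n; case: unpickle => [i|]; first exact: mF.
exact: sigma_algebra0.
Qed.

Variable G : sgraph.
Local Notation X := (salvetti_cover G).
Let D := @nonregular X.
Implicit Types (xi : orientation X) (L : {set G}) (g : raag G) (W : wall G).

(* The condition is closed: it fixes the values of coordinates. *)
Lemma borel_settled L g :
  borel_on D (D `&` [set xi | settled (wall_side xi) L g]).
Proof.
pose U := \bigcup_(W in [set W : wall G | W.2 \notin L])
  [set xi : orientation X | xi (wall_half W true) = ~~ pside W g].
have -> : D `&` [set xi | settled (wall_side xi) L g] = D `\` (D `&` U).
  apply/seteqP; split=> xi [Dxi].
    move=> st; split=> // -[_ [W WL /= e]]; have := st W WL.
    by rewrite /wall_side e; case: pside.
  move=> nU; split=> // W WL; apply: contrapT => ne; apply: nU; split=> //.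
  exists W => //=; move: ne; rewrite /wall_side.
  by case: pside; case: (xi _).
apply: sigma_algebraCD; apply: sub_sigma_algebra; exists U => //.
by apply: bigcup_open => W _; apply: open_eval.
Qed.

Lemma borel_core L g : borel_on D (D `&` [set xi | core (wall_side xi) L g]).
Proof.
(* [F] lists the ways to fail: [None] when [g] is not settled, [Some (w, L')] when [ev w] is settled
   for some [L'] not containing [L]. Words index the group elements, which keeps the union
   countable. *)
pose F (i : option (seq (G * bool) * {set G})) :=
  if i is Some (w, L') then
    if L \subset L' then set0 else D `&` [set xi | settled (wall_side xi) L' (ev w)]
  else D `\` (D `&` [set xi | settled (wall_side xi) L g]).
have -> : D `&` [set xi | core (wall_side xi) L g] = D `\` \bigcup_i F i.
  apply/seteqP; split=> xi [Dxi].
    move=> [st min]; split=> // -[[[w L']|] _ /=]; last by case=> _; apply.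
    by case: ifPn => // /negP nL [_ /min].
  move=> nF; split=> //; split.
    apply: contrapT => ns; apply: nF; exists None => //; split=> // -[_].
    exact: ns.
  move=> L' h sh; apply: contrapT => /negP nL; apply: nF.
  exists (Some (word_of h, L')) => //=; rewrite (negbTE nL) word_ofK.
  by split.
apply: sigma_algebraCD; apply: sigma_algebra_countable_bigcup => -[[w L']|] /=.
  by case: ifP => _; [apply: sigma_algebra0|apply: borel_settled].
by apply: sigma_algebraCD; apply: borel_settled.
Qed.

(** The assignment takes countably many values, indexed by a word and a type, so any preimage is a
    countable union of the sets of [borel_core]. *)
Lemma borel_core_complex (S : set (set (cell X))) :
  borel_on D (D `&` @core_complex G @^-1` S).
Proof.
pose F (i : seq (G * bool) * {set G}) := if `[< S (standard_at i.2 (ev i.1)) >]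
  then D `&` [set xi | core (wall_side xi) i.2 (ev i.1)] else set0.
have -> : D `&` @core_complex G @^-1` S = \bigcup_i F i.
  apply/seteqP; split=> xi.
    case=> Dxi /= Sxi; have [L [g cg]] := core_ex Dxi.1.
    exists (word_of g, L) => //; rewrite /F /= word_ofK.
    by case: asboolP => // -[]; rewrite -(core_complexE cg).
  case=> -[w L] _; rewrite /F /=; case: asboolP => // Sw [Dxi cw].
  by split=> //=; rewrite (core_complexE cw).
apply: sigma_algebra_countable_bigcup => -[w L]; rewrite /F /=.
by case: ifP => _; [apply: borel_core|apply: sigma_algebra0].
Qed.

End Measurability.

Theorem theorem7 (G : sgraph) :
  exists Y : orientation (salvetti_cover G) -> set (cell (salvetti_cover G)),
    [/\ forall xi, nonregular xi -> unique (carrier xi) (Y xi),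
        forall S : set (set (cell (salvetti_cover G))),
          borel_on (@nonregular (salvetti_cover G)) (@nonregular (salvetti_cover G) `&` Y @^-1` S),
        forall (g : raag G) xi, nonregular xi ->
          nonregular (push (translate g) xi) /\
          Y (push (translate g) xi) = translate g @` Y xi
      & forall xi, nonregular xi -> exists (L : {set G}) (Z : set (cell (salvetti_cover G))),
          [/\ standard_of_type L Z, is_join L & Y xi `<=` Z]].
Proof.
exists (@core_complex G); split.
- by move=> xi [bd _]; apply: core_complex_carrier.
- exact: borel_core_complex.
- exact: core_complex_equivariant.
- exact: core_complex_join.
Qed.
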